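(* Let $p$ be a prime. If Aschbacher's conjecture (for the prime $p$) holds for $p$-rank $3$, then it holds for any $p$-rank $r\geq 3$. Moreover, if the conjecture holds in $p$-rank $3$ for a simple group $L$ of order prime to $p$, then it holds in any $p$-rank $r\geq 3$ for $L$.
   Context: ''Simple group'' means non-abelian finite simple group. For a finite group $G$, $\mathcal{A}_p(G)$ is the poset of non-trivial elementary abelian $p$-subgroups of $G$ ordered by inclusion; topological notions for a finite poset refer to the geometric realization of its order complex, whose simplices are the non-empty chains. $F^*(G)$ is the generalized Fitting subgroup. Aschbacher's conjecture: Let $G$ be a finite group such that $G = AF^*(G)$, where $A$ is an elementary abelian $p$-subgroup of rank $r\geq 3$ (that is, $|A|=p^r$) and $F^*(G)$ is the direct product of the $A$-conjugates of a simple component $L$ of $G$ of order prime to $p$. Then $\mathcal{A}_p(G)$ is simply connected. The conjecture ''holds for $p$-rank $r$'' if its conclusion holds for all such $G$ with $A$ of that rank $r$. It ''holds in $p$-rank $r$ for $L$'' if its conclusion holds for all such $G$ with $A$ of rank $r$ and with simple component isomorphic to $L$. *)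

(* Defs.v *)
From mathcomp Require Import all_boot all_order all_algebra all_fingroup all_solvable.
From mathcomp Require Import all_classical reals topology normedtype.

Set Implicit Arguments.
Unset Strict Implicit.
Unset Printing Implicit Defensive.

Import numFieldNormedType.Exports.
Import GroupScope.
Local Open Scope group_scope.
Local Open Scope nat_scope.

Section Topology.
Local Open Scope classical_set_scope.
Local Open Scope ring_scope.

(* A subspace [S] is handled as a set of its ambient space [X]: a continuous
   map to [S] is a continuous map to [X] with values in [S]. *)
Definition path_in (R : realType) (X : topologicalType) (S : set X)
    (f : R -> X) (x y : X) : Prop :=
  [/\ {within `[0, 1], continuous f}, f @` `[0, 1] `<=` S, f 0 = x & f 1 = y].

Definition path_connected (R : realType) (X : topologicalType) (S : set X) :
    Prop :=
  forall x y, S x -> S y -> exists f : R -> X, path_in S f x y.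

(* [H] is a homotopy, relative to the endpoints, from the loop [f] based at
   [x] to the constant loop; its second argument is the time. *)
Definition null_homotopic (R : realType) (X : topologicalType) (S : set X)
    (f : R -> X) (x : X) : Prop :=
  exists H : R * R -> X,
    [/\ {within `[0, 1] `*` `[0, 1], continuous H},
        H @` (`[0, 1] `*` `[0, 1]) `<=` S,
        forall s : R, s \in `[0, 1] -> H (s, 0) = f s,
        forall s : R, s \in `[0, 1] -> H (s, 1) = x &
        forall t : R, t \in `[0, 1] -> H (0, t) = x /\ H (1, t) = x].

Definition simply_connected (R : realType) (X : topologicalType) (S : set X) :
    Prop :=
  [/\ S !=set0, path_connected R S &
      forall (x : X) (f : R -> X),
        S x -> path_in S f x x -> null_homotopic S f x].

End Topology.

Section OrderComplex.
Variables (V : finType) (le : rel V).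

Definition order_complex (P : {set V}) : {set {set V}} :=
  [set c : {set V} | [&& c != finset.set0, c \subset P &
     [forall x in c, forall y in c, le x y || le y x]]]%SET.

End OrderComplex.

(* Barycentric coordinates, with the topology induced from the finite product
   [R ^ V]. *)
Definition geometric_realization (R : realType) (V : finType)
    (K : {set {set V}}) : classical_sets.set (prod_topology (fun _ : V => R)) :=
  [set x : prod_topology (fun _ : V => R) |
     [/\ forall v, (0 <= x v)%R, (\sum_v x v = 1)%R &
         [set v | x v != 0%R]%SET \in K]]%classic.
Arguments geometric_realization R {V} K.

Section Groups.
Variable gT : finGroupType.
Implicit Types (G H K : {group gT}) (p : nat).

Definition nonabelian_simple H : bool := simple H && ~~ abelian H.

(* [simple] also allows groups of prime order, which perfectness excludes
   here. *)
Definition quasisimple H : bool := (H^`(1) == H) && simple (H / 'Z(H)).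

Definition component H G : bool := (H <|<| G) && quasisimple H.

Definition layer G : {set gT} :=
  << \bigcup_(H : {group gT} | component H G) H >>.

Definition generalized_Fitting G : {set gT} := 'F(G) <*> layer G.

Definition elementary_abelian_poset p G : {set {group gT}} :=
  'E_p(G) :\ 1%G.

Definition Ap_simply_connected (R : realType) p G : Prop :=
  simply_connected R
    (geometric_realization R
       (order_complex (fun E F : {group gT} => E \subset F)
          (elementary_abelian_poset p G))).

(* [L :^: A] is the set of distinct [A]-conjugates of [L]; the iterated [dprod]
   equals a group only if the internal product is direct. *)
Definition aschbacher_hypotheses p (r : nat) (G A L : {group gT}) : Prop :=
  [/\ p.-abelem A, #|A| = p ^ r,
      A \subset G, (A * generalized_Fitting G)%g = G &
      [/\ component L G, nonabelian_simple L, p^'.-group L &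
          \big[dprod/1%g]_(K in L :^: A) K = generalized_Fitting G]].

End Groups.

Definition aschbacher_conjecture_rank (R : realType) (p r : nat) : Prop :=
  forall (gT : finGroupType) (G A L : {group gT}),
    aschbacher_hypotheses p r G A L -> Ap_simply_connected R p G.

Definition aschbacher_conjecture_rank_for (R : realType) (p r : nat)
    (sT : finGroupType) (S : {group sT}) : Prop :=
  forall (gT : finGroupType) (G A L : {group gT}),
    aschbacher_hypotheses p r G A L -> L \isog S -> Ap_simply_connected R p G.

(* Main.v *)
Require Import Defs.
From mathcomp Require Import all_boot all_order all_algebra all_fingroup all_solvable.
From mathcomp Require Import all_classical reals topology normedtype.
From mathcomp Require Import ring lra zify.

Set Implicit Arguments.
Unset Strict Implicit.
Unset Printing Implicit Defensive.

Import Order.TTheory GRing.Theory Num.Theory.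
Import numFieldNormedType.Exports.
Import boot.fintype boot.finset.

(** Let [A] be an elementary abelian [p]-group acting on a [p']-group [N], and
    let [G = N A].  Every elementary abelian [p]-subgroup of [G] is an
    [N]-conjugate of a subgroup [E] of [A], and the conjugates of [E]
    correspond to the cosets of ['C_N(E)].  So the poset of [G] is a poset of
    cosets, and the principle of Brown and Abels-Holz applies: the poset is
    simply connected exactly when [N] is the amalgam of the subgroups
    ['C_N[a]], [a \in A^#], that is, when these generate [N] and all relations
    between their elements follow from the relations inside one ['C_N[a]]
    (lemmas [edge_simply_connected_amalgam] and
    [amalgam_edge_simply_connected]).

    The amalgam property is easy to move around, because a finite
    [p']-group is generated by the fixed points of the nontrivial elements of
    any elementary abelian group of order [p ^ 2] acting on it
    ([coprime_fixed_points]).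
    - It passes from a noncyclic [B <= A] to [A]: ['C_N[a]] is generated by
      its intersections with the ['C_N[b]], so a word over the fixed points of
      [A] rewrites into one over the fixed points of [B] ([amalgam_mono]).
    - If [B] has rank 3 it passes to direct products of [B]-invariant factors:
      each factor is generated by elements fixed by subgroups of rank 2, two
      such subgroups meet nontrivially, hence generators from different factors
      commute inside one ['C_N[b]] ([amalgam_dprod]).
    - It holds trivially if some [b] in [B^#] centralizes [N]
      ([amalgam_fixed]).

    Now let [A] have rank [r >= 3] and let [N = F*(G)] be the product of the
    [A]-conjugates of [L].  For [B <= A] of rank 3, [N] is the product of the
    subgroups [N_O] generated by the [B]-orbits [O] of conjugates of [L].  If
    [B] is not faithful on [N_O], the amalgam property is trivial; if it is,
    then [N_O B] satisfies the hypotheses of the conjecture in rank 3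
    ([orbit_hypotheses]), so its poset is simply connected and [N_O] is an
    amalgam.  By the rules above [N] is the amalgam of the ['C_N[b]], then of
    the ['C_N[a]], and the poset of [G] is simply connected.

    Simple connectedness is meant for the geometric realization, whereas the
    argument above sees only edge paths modulo elementary moves.  The two are
    related by grids of vertices in which each unit square lies in a
    simplex: a homotopy of the realization is sampled on a fine grid
    ([simply_connected_edge]), and a grid is interpolated to a homotopy
    ([edge_simply_connected_realization]). *)

(** * Rewriting of sequences *)

Section Rewriting.
Variables (T : Type) (step : seq T -> seq T -> Prop).

(** The congruence generated by [step].  It serves twice: for words in a group
    and for edge paths in a complex. *)
Inductive rewrites : seq T -> seq T -> Prop :=
| rew_step p q s t : step s t -> rewrites (p ++ s ++ q) (p ++ t ++ q)
| rew_refl s : rewrites s s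
| rew_sym s t : rewrites s t -> rewrites t s
| rew_trans s t u : rewrites s t -> rewrites t u -> rewrites s u.

Lemma rew1 s t : step s t -> rewrites s t.
Proof. by move=> /(rew_step [::] [::]); rewrite /= !cats0. Qed.

Lemma rew_ctx p q s t : rewrites s t -> rewrites (p ++ s ++ q) (p ++ t ++ q).
Proof.
elim=> {s t} [p' q' s t st|s|s t _|s t u _ IH1 _ IH2].
- by rewrite -!catA !(catA p); exact: rew_step.
- exact: rew_refl.
- exact: rew_sym.
- exact: rew_trans IH1 IH2.
Qed.

Lemma rew_cat s s' t t' :
  rewrites s s' -> rewrites t t' -> rewrites (s ++ t) (s' ++ t').
Proof.
move=> ss' tt'; apply: (@rew_trans _ (s' ++ t)).
  exact: (rew_ctx [::] t ss').
by have := rew_ctx s' [::] tt'; rewrite !cats0.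
Qed.

Lemma rew_cons x s t : rewrites s t -> rewrites (x :: s) (x :: t).
Proof. by move=> /(rew_cat (rew_refl [:: x])). Qed.

End Rewriting.
Arguments rew_trans {T step s} t {u}.

Lemma rewrites_map (T T' : Type) (step : seq T -> seq T -> Prop)
    (step' : seq T' -> seq T' -> Prop) (f : seq T -> seq T') :
  (forall p q s t, step s t ->
     rewrites step' (f (p ++ s ++ q)) (f (p ++ t ++ q))) ->
  forall s t, rewrites step s t -> rewrites step' (f s) (f t).
Proof.
move=> fP s t; elim=> {s t} [p q s t|s|s t _|s t u _ IH1 _ IH2].
- exact: fP.
- exact: rew_refl.
- exact: rew_sym.
- exact: rew_trans IH1 IH2.
Qed.

(** * Edge paths in a finite simplicial complex *)

Section EdgePaths.
Variables (V : finType) (K : {set {set V}}).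

Definition adjacent u v := [set u; v]%SET \in K.

Definition down_closed :=
  forall c d : {set V}, c \in K -> d \subset c -> d != set0 -> d \in K.

(** The moves carry no condition on the rest of the path, so [edge_homotopic]
    also relates sequences that are not edge paths; being an edge path is
    invariant all the same, see [edge_homotopic_path]. *)
Inductive edge_move : seq V -> seq V -> Prop :=
| triangle_move u v w :
    [set u; v; w]%SET \in K -> edge_move [:: u; v; w] [:: u; w]
| repeat_move u : edge_move [:: u; u] [:: u].

Definition edge_homotopic := rewrites edge_move.

Definition edge_simply_connected :=
  [/\ exists v, [set v]%SET \in K,
      forall u v, [set u]%SET \in K -> [set v]%SET \in K ->
        exists2 s, path adjacent u s & last u s = v
    & forall u s, [set u]%SET \in K -> path adjacent u s -> last u s = u ->
        edge_homotopic (u :: s) [:: u]].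

Lemma edge_triangle u v w :
  [set u; v; w]%SET \in K -> edge_homotopic [:: u; v; w] [:: u; w].
Proof. by move=> uvw; apply/rew1/triangle_move. Qed.

Lemma edge_repeat u : edge_homotopic [:: u; u] [:: u].
Proof. exact/rew1/repeat_move. Qed.

Hypothesis Kdown : down_closed.

Lemma face2 (c : {set V}) u v :
  c \in K -> u \in c -> v \in c -> [set u; v]%SET \in K.
Proof.
move=> cK uc vc; apply: (Kdown cK); first by rewrite subUset !sub1set uc.
by apply/set0Pn; exists u; rewrite !inE eqxx.
Qed.

Lemma face3 (c : {set V}) u v w :
  c \in K -> u \in c -> v \in c -> w \in c -> [set u; v; w]%SET \in K.
Proof.
move=> cK uc vc wc; apply: (Kdown cK); first by rewrite !subUset !sub1set uc vc.
by apply/set0Pn; exists u; rewrite !inE eqxx.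
Qed.

Lemma face4 (c : {set V}) u v w x : c \in K ->
  u \in c -> v \in c -> w \in c -> x \in c -> [set u; v; w; x]%SET \in K.
Proof.
move=> cK uc vc wc xc; apply: (Kdown cK).
  by rewrite !subUset !sub1set uc vc wc.
by apply/set0Pn; exists u; rewrite !inE eqxx.
Qed.

Lemma vertex_adjacent u v : adjacent u v -> [set u]%SET \in K /\ [set v]%SET \in K.
Proof. by move=> uv; rewrite -[[set u]%SET]setUid -[[set v]%SET]setUid; split;
  apply: face2 uv _ _; rewrite !inE eqxx ?orbT. Qed.

(** Two infinite rows of vertices, one above the other, such that each unit
    square of the strip between them lies in a simplex. *)
Definition contiguous (p q : nat -> V) :=
  forall i, [set p i; p i.+1; q i; q i.+1]%SET \in K.

Lemma contiguous_sym p q : contiguous p q -> contiguous q p.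
Proof.
by move=> pq i; have := pq i; rewrite -setUA setUC setUA.
Qed.

(** The strip between the rows is swept from right to left: the path
    [p 0, .., p k, q k, .., q n], which goes down in column [k], is moved to the
    one that goes down in column [k.-1] by two triangles of a unit square. *)
Lemma contiguous_homotopic (p q : nat -> V) n :
    contiguous p q -> p 0 = q 0 -> p n = q n ->
  edge_homotopic (mkseq p n.+1) (mkseq q n.+1).
Proof.
move=> pq pq0 pqn.
have swap k : edge_homotopic (rcons (mkseq p k.+1) (q k)) (p 0 :: mkseq q k.+1).
  elim: k => [|k IHk]; first exact: rew_refl.
  have pqk := pq k.
  have mk (r : nat -> V) m : mkseq r m.+1 = rcons (mkseq r m) (r m).
    by rewrite /mkseq -addn1 iotaD map_cat add0n cats1.
  rewrite (mk p k.+1) (mk q k.+1) -rcons_cons.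
  apply: (rew_trans (mkseq p k ++ [:: p k; q k.+1])).
    rewrite mk -!cats1 -!catA /=; apply: rew_cat (rew_refl _ _) _.
    by apply: edge_triangle; apply: face3 pqk _ _ _; rewrite !inE eqxx ?orbT.
  apply: (rew_trans (mkseq p k ++ [:: p k; q k; q k.+1])).
    apply: rew_sym; apply: rew_cat (rew_refl _ _) _.
    by apply: edge_triangle; apply: face3 pqk _ _ _; rewrite !inE eqxx ?orbT.
  have -> : mkseq p k ++ [:: p k; q k; q k.+1] =
            rcons (mkseq p k.+1) (q k) ++ [:: q k.+1].
    by rewrite mk -!cats1 -!catA.
  by rewrite -[rcons (_ :: _) _]cats1; apply: rew_cat IHk (rew_refl _ _).
have dupr (r : nat -> V) k : edge_homotopic (rcons (mkseq r k.+1) (r k)) (mkseq r k.+1).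
  rewrite /mkseq -addn1 iotaD map_cat add0n /= -cats1 -catA.
  exact: rew_cat (rew_refl _ _) (edge_repeat _).
apply: rew_trans (rew_sym (dupr p n)) _; rewrite pqn.
apply: rew_trans (swap n) _; rewrite pq0.
have -> : mkseq q n.+1 = [::] ++ [:: q 0] ++ behead (mkseq q n.+1) by [].
exact: (@rew_step _ _ [::] _ [:: q 0; q 0]) (repeat_move _).
Qed.

(** A finite stack of contiguous rows from [p] to [q]; the left end and
    everything to the right of column [N] are kept fixed. *)
Definition grid_homotopic (p q : nat -> V) :=
  exists m N (r : nat -> nat -> V),
    [/\ r 0 =1 p, r m =1 q,
        forall j, j < m -> contiguous (r j) (r j.+1),
        forall j, j <= m -> r j 0 = p 0
      & forall i j, j <= m -> N <= i -> r j i = p i].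

Lemma eq_contiguous p p' q q' :
  p =1 p' -> q =1 q' -> contiguous p q -> contiguous p' q'.
Proof. by move=> pp' qq' pq i; rewrite -!pp' -!qq'. Qed.

Lemma grid_step p q N : contiguous p q -> p 0 = q 0 ->
  (forall i, N <= i -> q i = p i) -> grid_homotopic p q.
Proof.
move=> pq pq0 qN; exists 1, N, (fun j => if j is 0 then p else q).
by split=> // [[]|[|j]|i [|j]] //= _; apply: qN.
Qed.

Lemma grid_refl p q : p =1 q -> grid_homotopic p q.
Proof. by move=> pq; exists 0, 0, (fun _ => p); split. Qed.

Lemma grid_sym p q : grid_homotopic p q -> grid_homotopic q p.
Proof.
move=> [m [N [r [r0 rm rS rl rN]]]].
exists m, N, (fun j => r (m - j)); split=> [i|i|j jm|j _|i j _ Ni].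
- by rewrite subn0.
- by rewrite subnn.
- have -> : m - j = (m - j.+1).+1 by lia.
  by apply/contiguous_sym/rS; lia.
- by rewrite -rm !rl ?leq_subr.
- by rewrite -rm !rN ?leq_subr.
Qed.

Lemma grid_trans p q s :
  grid_homotopic p q -> grid_homotopic q s -> grid_homotopic p s.
Proof.
move=> [m [N [r [r0 rm rS rl rN]]]] [m' [N' [r' [r'0 r'm r'S r'l r'N]]]].
exists (m + m'), (maxn N N'), (fun j => if j <= m then r j else r' (j - m)).
split=> [i|i|j jm|j jmm|i j jmm].
- by rewrite leq0n.
- case: ifP => [mm|_]; last by rewrite addKn.
  have m'0 : m' = 0 by lia.
  by rewrite m'0 addn0 rm -r'0 -r'm m'0.
- case: (ltngtP j m) jm => [jm'|jm'|->] jm; first exact: rS.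
    by rewrite subSn 1?ltnW //; apply: r'S; lia.
  rewrite subSnn; case: m' {r'm r'l r'N} jm r'S => [|m'] jm r'S; first by lia.
  apply: (eq_contiguous _ (fun=> erefl)) (r'S 0 isT) => i.
  by rewrite r'0 rm.
- case: ifP => [|jm]; first exact: rl.
  by rewrite r'l -?rm ?rl //; lia.
- rewrite geq_max => /andP[Ni N'i].
  case: ifP => [jm|jm]; first exact: rN.
  by rewrite r'N -?rm ?rN //; lia.
Qed.

Definition stutter k (p : nat -> V) i := if i <= k then p i else p i.-1.

(** Rows of a grid have no length, so a repeated entry can be pushed to the
    right, one contiguous row at a time, until it disappears into the constant
    tail. *)
Lemma grid_stutter p k N : (forall i, adjacent (p i) (p i.+1)) ->
  (forall i, N <= i -> p i = p N) -> grid_homotopic p (stutter k p).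
Proof.
move=> pP pN; have pN' i j : N <= i -> N <= j -> p i = p j.
  by move=> Ni Nj; rewrite pN // (pN j).
have [d] := ubnP (N - k); elim: d => // d IHd in k *; rewrite ltnS => Nkd.
have [Nk|kN] := leqP N k.
  apply: grid_refl => i; rewrite /stutter; case: leqP => // ki.
  by apply: pN'; lia.
apply: grid_trans (IHd k.+1 _) _; first by lia.
apply/grid_sym/(@grid_step _ _ N.+1) => // [i|i Ni]; last first.
  by rewrite /stutter; do 2?case: leqP => ?; apply: pN'; lia.
have pPi := pP i; have pPi' := pP i.-1.
rewrite /stutter; case: (ltngtP i k) => [ik|ki|->].
- rewrite (leqW (ltnW ik)) ltnS (ltnW ik) -setUA setUid.
  exact: pP.
- rewrite ltnS [i <= k]leqNgt ki /=.
  case: (ltngtP i k.+1) => [|ki'|->] /=; first by rewrite ltnNge ki.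
  + rewrite -setUA setUid.
    by move: pPi'; rewrite prednK //; lia.
  + by rewrite -!setUA !setUid; exact: pP.
- rewrite leqnSn leqnn /=.
  by rewrite !setUid; exact: pP.
Qed.

(** An edge path becomes a row by repeating its last vertex forever. *)
Definition pad v0 (s : seq V) i := nth (last v0 s) s i.

Lemma pad_size v0 s i : size s <= i.+1 -> pad v0 s i = last v0 s.
Proof.
rewrite /pad leq_eqVlt => /predU1P[si|si]; last by rewrite nth_default.
by rewrite -[i in LHS]/(i.+1.-1) -si nth_last; case: s {si}.
Qed.

Definition edge_path s := sorted adjacent s && all (fun v => [set v]%SET \in K) s.

Lemma path_edge_path u s :
  [set u]%SET \in K -> path adjacent u s -> edge_path (u :: s).
Proof.
rewrite /edge_path /= => -> us; rewrite us /=.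
elim: s u us => //= v s IHs u /andP[/vertex_adjacent[_ ->]]; exact: IHs.
Qed.

Lemma edge_path_pad v0 s i : s != [::] -> edge_path s ->
  adjacent (pad v0 s i) (pad v0 s i.+1).
Proof.
move=> sn0 /andP[/(sortedP (last v0 s)) sP /allP sV].
have [si|si] := ltnP i.+1 (size s); first exact: sP.
rewrite !pad_size //; last exact: leqW.
rewrite /adjacent setUid; apply: sV.
by case: s sn0 {sP si} => //= x s _; exact: mem_last.
Qed.

Lemma pad_repeat v0 p u q i :
  pad v0 (p ++ [:: u; u] ++ q) i = stutter (size p) (pad v0 (p ++ u :: q)) i.
Proof.
rewrite /stutter /pad !last_cat /= !nth_cat.
case: (ltngtP i (size p)) => [//|ip|->]; last by rewrite subnn.
rewrite ltnNge -ltnS prednK ?ip /=; last by lia.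
by rewrite (_ : i - size p = (i.-1 - size p).+1) //=; lia.
Qed.

Lemma edge_path_move p q s t : edge_move s t ->
  edge_path (p ++ s ++ q) = edge_path (p ++ t ++ q).
Proof.
have sE (r : seq V) x r' : sorted adjacent (r ++ x :: r') =
    sorted adjacent (rcons r x) && path adjacent x r'.
  by case: r => //= y r; rewrite cat_path rcons_path /= andbA.
rewrite /edge_path => -[u v w uvw|u]; rewrite !all_cat /= !sE /=.
- have f x y : x \in [set u; v; w] -> y \in [set u; v; w] -> adjacent x y.
    exact: face2.
  have fv : [set v] \in K by rewrite -[[set v]]setUid; apply: f; rewrite !inE eqxx ?orbT.
  by rewrite (f u v) ?(f v w) ?(f u w) ?inE ?eqxx ?orbT //= fv.
- have -> : adjacent u u = ([set u] \in K) by rewrite /adjacent setUid.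
  by case: ([set u] \in K); rewrite ?andbF.
Qed.

Lemma edge_homotopic_nil s t : edge_homotopic s t -> (s == [::]) = (t == [::]).
Proof.
elim=> {s t} [p q s t st|s|s t _ ->|s t u _ -> _ ->] //.
by case: p => //; case: st.
Qed.

Lemma edge_homotopic_path s t : edge_homotopic s t -> edge_path s = edge_path t.
Proof.
elim=> {s t} [p q s t st|s|s t _ ->|s t u _ -> _ ->] //.
exact: edge_path_move.
Qed.

(** A move changes the length of a path; padding turns it into a stutter, which
    [grid_stutter] absorbs, followed for a triangle by the change of one entry. *)
Lemma edge_homotopic_grid v0 s t : edge_homotopic s t ->
  s != [::] -> edge_path s -> grid_homotopic (pad v0 s) (pad v0 t).
Proof.
have padN r j : size r <= j -> pad v0 r j = pad v0 r (size r).
  by move=> rj; rewrite !pad_size // ltnW.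
have stutterP p u q : edge_path (p ++ u :: q) ->
    grid_homotopic (pad v0 (p ++ u :: q)) (pad v0 (p ++ [:: u; u] ++ q)).
  move=> puq; apply: (@grid_trans _ (stutter (size p) (pad v0 (p ++ u :: q)))).
    apply: (@grid_stutter _ _ (size (p ++ u :: q))) => i; last exact: padN.
    by apply: edge_path_pad => //; case: p {puq}.
  by apply: grid_refl => i; rewrite pad_repeat.
suff gridP p q s' t' : edge_move s' t' -> edge_path (p ++ s' ++ q) ->
    grid_homotopic (pad v0 (p ++ s' ++ q)) (pad v0 (p ++ t' ++ q)).
  elim=> {s t} [p q s t st _|s _ _|s t st IH|s t u st IH tu IH'].
  - exact: gridP.
  - exact: grid_refl.
  - rewrite -(edge_homotopic_path st) -(edge_homotopic_nil st) => s0 sP.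
    exact/grid_sym/IH.
  - move=> s0 sP; apply: grid_trans (IH s0 sP) (IH' _ _).
      by rewrite -(edge_homotopic_nil st).
    by rewrite -(edge_homotopic_path st).
case=> [u v w uvw|u] pP; last first.
  apply/grid_sym/stutterP; move: pP.
  by rewrite (edge_path_move _ _ (repeat_move u)).
have pP' := pP; rewrite (edge_path_move _ _ (triangle_move uvw)) in pP'.
(* With [u, w] stuttered to [u, u, w], the two rows differ only in column
   [(size p).+1]: this is [f v] against [f u]. *)
apply: grid_trans _ (grid_sym (stutterP p u (w :: q) pP')).
pose f x i := nth (last w q) (p ++ [:: u, x, w & q]) i.
have fE x : pad v0 (p ++ [:: u; x; w] ++ q) = f x.
  by apply/funext=> i; rewrite /pad last_cat.
have f0 x : f x (size p) = u by rewrite /f nth_cat ltnn subnn.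
have f1 x : f x (size p).+1 = x.
  by rewrite /f nth_cat ltnNge leqnSn subSn // subnn.
have f2 x : f x (size p).+2 = w.
  by rewrite /f nth_cat ltnNge (leqW (leqnSn _)) !subSn ?leqnSn // subnn.
have fN x i : i != (size p).+1 -> f x i = f u i.
  move=> ip; rewrite /f !nth_cat; case: ltnP => // pi.
  by case: (i - size p) (subnKC pi) ip => [|[|]] //= <-; rewrite addn1 eqxx.
have adjf i : adjacent (f v i) (f v i.+1).
  by rewrite -fE; apply: edge_path_pad => //; case: (p).
rewrite (fE v) (fE u : pad v0 (p ++ [:: u; u] ++ w :: q) = _).
apply: (@grid_step _ _ (size p).+2) => [i||i pi].
- have [->|i0] := eqVneq i (size p).
    by rewrite !f0 !f1; apply: face4 uvw _ _ _ _; rewrite !inE eqxx ?orbT.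
  have [->|i1] := eqVneq i (size p).+1.
    by rewrite !f1 !f2; apply: face4 uvw _ _ _ _; rewrite !inE eqxx ?orbT.
  rewrite !(fN v) ?eqSS // -setUA setUid.
  by have := adjf i; rewrite !(fN v) ?eqSS.
- by rewrite fN // ; case: (size p).
- by rewrite fN //; lia.
Qed.

End EdgePaths.

(** * Continuity of maps into a product of real lines *)

Section Continuity.
Variables (R : realType).
Local Open Scope classical_set_scope.
Local Open Scope ring_scope.

Lemma continuous_add (T : topologicalType) (f g : T -> R) :
  continuous f -> continuous g -> continuous (fun t => f t + g t).
Proof. by move=> cf cg t; apply: continuousD; [exact: cf | exact: cg]. Qed.

Lemma continuous_mul (T : topologicalType) (f g : T -> R) :
  continuous f -> continuous g -> continuous (fun t => f t * g t).
Proof. by move=> cf cg t; apply: continuousM; [exact: cf | exact: cg]. Qed.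

Lemma continuous_opp (T : topologicalType) (f : T -> R) :
  continuous f -> continuous (fun t => - f t).
Proof. by move=> cf t; apply: continuousN; exact: cf. Qed.

Lemma continuous_sum (T : topologicalType) (I : finType) (f : I -> T -> R) :
  (forall i, continuous (f i)) -> continuous (fun t => \sum_i f i t).
Proof.
move=> cf t; apply: (@cvg_big _ I +%R) => [|i _]; last exact: cf.
exact: add_continuous.
Qed.

Definition clamp (x : R) : R := Num.min 1 (Num.max 0 x).

Lemma clamp_ge0 x : 0 <= clamp x.
Proof. by rewrite /clamp le_min ler01 le_max lexx. Qed.

Lemma clamp_le1 x : clamp x <= 1.
Proof. by rewrite /clamp ge_min lexx. Qed.

Lemma clamp_id x : 0 <= x <= 1 -> clamp x = x.
Proof. by move=> /andP[x0 x1]; rewrite /clamp max_r // min_r. Qed.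

Lemma clamp0 x : x <= 0 -> clamp x = 0.
Proof. by move=> x0; rewrite /clamp max_l // min_r. Qed.

Lemma clamp1 x : 1 <= x -> clamp x = 1.
Proof. by move=> x1; rewrite /clamp min_l // le_max x1 orbT. Qed.

Lemma clamp_homo x y : x <= y -> clamp x <= clamp y.
Proof.
by move=> xy; rewrite /clamp le_min2 // le_max2.
Qed.

Lemma continuous_clamp (T : topologicalType) (f : T -> R) :
  continuous f -> continuous (fun t => clamp (f t)).
Proof.
move=> cf; apply: (@min_fun_continuous _ T R (fun=> 1)) => [t|].
  exact: cst_continuous.
by apply: (@max_fun_continuous _ T R (fun=> 0)) => // t; exact: cst_continuous.
Qed.

(** With [g := clamp] this extends a map that is continuous on the unit interval
    to the whole line, so that later formulas are continuous everywhere. *)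
Lemma continuous_comp_within (S T U : topologicalType) (A : set T)
    (g : S -> T) (f : T -> U) :
  {within A, continuous f} -> continuous g -> (forall s, A (g s)) ->
  continuous (f \o g).
Proof.
move=> /subspace_continuousP cf cg Ag s.
apply: (@cvg_comp _ _ _ _ _ _ (within A (nbhs (g s)))); last exact: cf.
by move=> P /cg; apply: (@filterS S (nbhs s)) => t /=; apply; exact: Ag.
Qed.

Variable V : finType.
Notation X := (prod_topology (fun _ : V => R)).

Lemma continuous_coordinates (T : topologicalType) (f : T -> X) :
  (forall v, continuous (fun t => f t v)) -> continuous f.
Proof.
move=> cf t; apply/cvg_sup => v.
exact: (@continuous_comp_initial _ _ _ (fun x : X => x v) f (cf v) t).
Qed.

Lemma coordinate_continuous (T : topologicalType) (f : T -> X) v :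
  continuous f -> continuous (fun t => f t v).
Proof.
move=> cf t; apply: (@continuous_comp _ _ _ f (fun x : X => x v)); first exact: cf.
exact: (@proj_continuous V (fun=> R) v).
Qed.

End Continuity.

(** * Interpolation in the geometric realization *)

Section Interpolation.
Variables (R : realType) (V : finType) (K : {set {set V}}).
Local Open Scope classical_set_scope.
Local Open Scope ring_scope.
Notation X := (prod_topology (fun _ : V => R)).
Notation real := (@geometric_realization R V K).

Definition supp (x : X) : {set V} := [set v | x v != 0]%SET.

Lemma supp_in x : real x -> supp x \in K. Proof. by case. Qed.

Hypothesis Kdown : down_closed K.

Definition combination (I : finType) (c : I -> R) (y : I -> X) : X :=
  fun v => \sum_i c i * y i v.

(** The realization contains the convex hull of points whose supports lie in a
    common simplex.  All homotopies below stay in the realization for this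
    reason. *)
Lemma combination_in (I : finType) (c : I -> R) (y : I -> X) (S : {set V}) :
    S \in K -> (forall i, 0 <= c i) -> \sum_i c i = 1 ->
    (forall i, c i != 0 -> real (y i) /\ supp (y i) \subset S) ->
  real (combination c y) /\ supp (combination c y) \subset S.
Proof.
move=> SK c0 c1 cy.
have yP i v : 0 <= c i * y i v.
  have [->|/cy[[yi0 _ _] _]] := eqVneq (c i) 0; first by rewrite mul0r.
  exact: mulr_ge0.
have sub : supp (combination c y) \subset S.
  apply/subsetP => v; rewrite inE; apply: contraR => vS.
  apply/eqP/big1 => i _; have [->|/cy[_ /subsetP/(_ v)]] := eqVneq (c i) 0.
    by rewrite mul0r.
  rewrite inE; have [->|_] := eqVneq (y i v) 0; first by rewrite mulr0.
  by move=> /(_ isT); rewrite (negPf vS).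
have sum1 : \sum_v combination c y v = 1.
  rewrite exchange_big /= -c1; apply: eq_bigr => i _.
  have [->|/cy[[_ yi1 _] _]] := eqVneq (c i) 0.
    by rewrite big1 // => v _; rewrite mul0r.
  by rewrite -mulr_sumr yi1 mulr1.
split=> //; split=> // [v|]; first exact: sumr_ge0.
apply: Kdown SK sub _; apply: contraTneq isT => s0.
have /eqP := sum1; rewrite big1 ?(eq_sym 0) ?oner_eq0 // => v _.
by have := in_set0 v; rewrite -s0 inE => /negbFE/eqP.
Qed.

Lemma combination_const (I : finType) (c : I -> R) (y : I -> X) x :
    \sum_i c i = 1 -> (forall i, c i != 0 -> y i = x) -> combination c y = x.
Proof.
move=> c1 cy; apply/funext => v; rewrite /combination -[RHS]mul1r -c1 mulr_suml.
apply: eq_bigr => i _; have [->|/cy->//] := eqVneq (c i) 0.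
by rewrite !mul0r.
Qed.

Definition mix (c : R) (x y : X) : X := fun v => (1 - c) * x v + c * y v.

Lemma mix_in (c : R) x y (S : {set V}) : S \in K -> 0 <= c <= 1 ->
    real x -> supp x \subset S -> real y -> supp y \subset S ->
  real (mix c x y) /\ supp (mix c x y) \subset S.
Proof.
move=> SK /andP[c0 c1] xK xS yK yS.
have -> : mix c x y =
    combination (fun b : bool => if b then 1 - c else c) (fun b => if b then x else y).
  by apply/funext => v; rewrite /mix /combination big_bool.
apply: combination_in => // [[]||[]] //; rewrite ?subr_ge0 //.
by rewrite big_bool /= subrK.
Qed.

Lemma mix0 x y : mix 0 x y = x.
Proof. by apply/funext => v; rewrite /mix subr0 mul1r mul0r addr0. Qed.

Lemma mix1 x y : mix 1 x y = y.
Proof. by apply/funext => v; rewrite /mix subrr mul1r mul0r add0r. Qed.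

Lemma mixxx c x : mix c x x = x.
Proof. by apply/funext => v; rewrite /mix -mulrDl subrK mul1r. Qed.

Definition vertex (u : V) : X := fun v => (v == u)%:R.

Lemma supp_vertex u : supp (vertex u) = [set u]%SET.
Proof. by apply/setP => v; rewrite !inE /vertex pnatr_eq0; case: (v == u). Qed.

Lemma vertex_in u : [set u]%SET \in K -> real (vertex u).
Proof.
move=> uK; split=> [v||]; first by rewrite /vertex ler0n.
  rewrite (bigD1 u) //= big1 ?addr0 /vertex ?eqxx // => v /negPf -> //.
by move: uK; rewrite -supp_vertex.
Qed.

(** ** Hat functions *)

(** The tent function with peak at [i].  As a difference of consecutive clamps,
    the tents telescope to a partition of unity. *)
Definition hat (i : nat) (u : R) : R := clamp (u + 1 - i%:R) - clamp (u + 1 - i.+1%:R).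

Lemma hat_ge0 i u : 0 <= hat i u.
Proof. by rewrite subr_ge0 clamp_homo // lerB ?ler_nat. Qed.

Lemma hat_neq0 i u : hat i u != 0 -> (i%:R - 1 < u) /\ (u < i%:R + 1).
Proof.
move=> h; split; rewrite ltNge; apply: contraNN h => h; rewrite /hat subr_eq0.
  by rewrite !clamp0 // ?mulrS; lra.
by rewrite !clamp1 // ?mulrS; lra.
Qed.

Lemma hat_sum M (u : R) : 0 <= u <= M%:R -> \sum_(i < M.+1) hat i u = 1.
Proof.
move=> /andP[u0 uM].
rewrite -(big_mkord xpredT (fun i => hat i u)) /=.
under eq_bigr do rewrite /hat -opprB.
rewrite sumrN telescope_sumr // opprB subr0 (@clamp1 _ (u + 1)); last by lra.
by rewrite clamp0 ?subr0 // mulrS; lra.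
Qed.

Lemma hat_nat i k : hat i k%:R != 0 -> i = k.
Proof.
move=> /hat_neq0[]; rewrite ltrBlDr !natr1 !ltr_nat; lia.
Qed.

Lemma continuous_hat (T : topologicalType) i (f : T -> R) :
  continuous f -> continuous (fun t => hat i (f t)).
Proof.
move=> cf; have ramp (a : R) : continuous (fun t => clamp (f t + 1 - a)).
  apply/continuous_clamp/continuous_add => [|t]; last exact: cst_continuous.
  by apply: continuous_add => // t; exact: cst_continuous.
by apply/continuous_add/continuous_opp; exact: ramp.
Qed.

Variables (M m : nat) (q : nat -> nat -> X).

(** Bilinear interpolation of the points [q i j] placed at the integer points
    [(i, j)] of the rectangle [0, M] x [0, m]. *)
Definition grid_map (u t : R) : X :=
  combination (fun ij : 'I_M.+1 * 'I_m.+1 => hat ij.1 u * hat ij.2 t)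
    (fun ij => q ij.1 ij.2).

Lemma grid_sum (u t : R) : 0 <= u <= M%:R -> 0 <= t <= m%:R ->
  \sum_(ij : 'I_M.+1 * 'I_m.+1) hat ij.1 u * hat ij.2 t = 1.
Proof.
move=> uM tm; rewrite -(pair_bigA _ (fun i j => hat (val i) u * hat (val j) t)) /=.
under eq_bigr do rewrite -mulr_sumr hat_sum // mulr1.
exact: hat_sum.
Qed.

Lemma grid_in (u t : R) (S : {set V}) : 0 <= u <= M%:R -> 0 <= t <= m%:R ->
    S \in K ->
    (forall i j, hat i u != 0 -> hat j t != 0 -> real (q i j) /\ supp (q i j) \subset S) ->
  real (grid_map u t) /\ supp (grid_map u t) \subset S.
Proof.
move=> uM tm SK qS; apply: combination_in => // [ij||ij].
- by rewrite mulr_ge0 ?hat_ge0.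
- exact: grid_sum.
- by rewrite mulf_eq0 negb_or => /andP[]; exact: qS.
Qed.

Lemma grid_const (u t : R) x : 0 <= u <= M%:R -> 0 <= t <= m%:R ->
    (forall i j, hat i u != 0 -> hat j t != 0 -> q i j = x) ->
  grid_map u t = x.
Proof.
move=> uM tm qx; apply: combination_const => [|ij]; first exact: grid_sum.
by rewrite mulf_eq0 negb_or => /andP[]; exact: qx.
Qed.

Lemma hat_near (u : R) i : 0 <= u -> hat i u != 0 ->
  i = Num.truncn u \/ i = (Num.truncn u).+1.
Proof.
move=> u0 /hat_neq0[iu ui]; have /andP[ku uk] := truncn_itv u0.
have : (i%:R : R) < (Num.truncn u).+2%:R by rewrite -(natr1 _.+1); lra.
have : (Num.truncn u)%:R < (i.+1%:R : R) by rewrite -natr1; lra.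
by rewrite !ltr_nat; lia.
Qed.

Lemma continuous_grid (T : topologicalType) (f g : T -> R) v :
  continuous f -> continuous g -> continuous (fun t => grid_map (f t) (g t) v).
Proof.
move=> cf cg; apply: continuous_sum => ij.
apply: continuous_mul => [|t]; last exact: cst_continuous.
by apply: continuous_mul; apply: continuous_hat.
Qed.

End Interpolation.

(** * Combinatorial discs give homotopies *)

Section Realization.
Variables (R : realType) (V : finType) (K : {set {set V}}).
Local Open Scope classical_set_scope.
Local Open Scope ring_scope.
Notation X := (prod_topology (fun _ : V => R)).
Notation real := (@geometric_realization R V K).
Hypothesis Kdown : down_closed K.

(** The four corners of the unit square at [(i, j)] have supports in one
    simplex.  The corners are arbitrary points of the realization rather than
    vertices, since the base point of a loop need not be a vertex. *)
Definition common_simplex (q : nat -> nat -> X) i j :=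
  exists2 S, S \in K & forall a b : bool,
    real (q (i + a)%N (j + b)%N) /\ supp (q (i + a)%N (j + b)%N) \subset S.

Lemma grid_map_in M m (q : nat -> nat -> X) (u t : R) :
    0 <= u <= M%:R -> 0 <= t <= m%:R -> (forall i j, common_simplex q i j) ->
  real (grid_map M m q u t).
Proof.
move=> uM tm qK.
have [S SK qS] := qK (Num.truncn u) (Num.truncn t).
apply: (proj1 (grid_in Kdown uM tm SK _)) => i j.
have [/andP[u0 _] /andP[t0 _]] := (uM, tm).
have near (k l : nat) : l = k \/ l = k.+1 -> exists a : bool, l = (k + a)%N.
  by case=> ->; [exists false; rewrite addn0 | exists true; rewrite addn1].
move=> /(hat_near u0)/near[a ->] /(hat_near t0)/near[b ->]; exact: qS.
Qed.

Lemma continuous_mix (T : topologicalType) (c : T -> R) (f g : T -> X) :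
  continuous c -> continuous f -> continuous g ->
  continuous (fun t => mix (c t) (f t) (g t) : X).
Proof.
move=> cc cf cg; apply: continuous_coordinates => v; apply: continuous_add.
  apply: continuous_mul; last exact: coordinate_continuous.
  by apply: continuous_add => [t|]; [exact: cst_continuous | exact: continuous_opp].
by apply: continuous_mul => //; exact: coordinate_continuous.
Qed.

Lemma mem01 (s : R) : (s \in `[0, 1]) = (0 <= s <= 1).
Proof. by rewrite in_itv. Qed.

(** A grid whose bottom row follows [f] closely and whose other three sides are
    constant yields a null homotopy of [f].  The homotopy has three stages, one
    for each third of the time interval:
    - [f] is reparametrized to [s |-> f (clamp ((M s - 1) / n))];
    - that loop is moved on straight lines to the interpolation of the bottom
      row, which is possible by the hypothesis on supports;
    - the bottom row is moved up the grid.
    The clamps [t1], [t2] and [t3] run through their ranges one after the other,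
    so a single formula covers the three stages. *)
Lemma null_homotopic_grid (x : X) (f : R -> X) n M m (q : nat -> nat -> X) :
    path_in real f x x -> (0 < n)%N -> (n.+1 <= M)%N ->
    (forall i j, common_simplex q i j) ->
    (forall j, q 0%N j = x) -> (forall i j, (M <= i)%N -> q i j = x) ->
    (forall i j, (m <= j)%N -> q i j = x) ->
    (forall (u : R) i, 0 <= u -> hat i u != 0 ->
       supp (q i 0%N) \subset supp (f (clamp ((u - 1) / n%:R)))) ->
  null_homotopic real f x.
Proof.
move=> [cf fK f0 f1] n0 nM qK q0 qM qm qf.
have fK' s : real (f (clamp s)).
  by apply: fK; exists (clamp s) => //=; rewrite mem01 clamp_ge0 clamp_le1.
have cf' : continuous (fun s => f (clamp s)).
  apply: continuous_comp_within cf _ _; first by apply: continuous_clamp => s.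
  by move=> s; rewrite /= mem01 clamp_ge0 clamp_le1.
have nR : (0 : R) < n%:R by rewrite ltr0n.
have MR : (n%:R + 1 : R) <= M%:R by rewrite natr1 ler_nat.
pose t1 (t : R) := clamp (3 * t); pose t2 (t : R) := clamp (3 * t - 1).
pose t3 (t : R) := m%:R * clamp (3 * t - 2).
pose al (s t : R) := (1 - t1 t) * s + t1 t * clamp ((M%:R * s - 1) / n%:R).
pose H (st : R * R) : X :=
  mix (t2 st.2) (f (clamp (al st.1 st.2))) (grid_map M m q (M%:R * st.1) (t3 st.2)).
have t3P t : 0 <= t3 t <= m%:R.
  by rewrite /t3 mulr_ge0 ?clamp_ge0 // ler_piMr ?clamp_le1.
have MP (s : R) : 0 <= s <= 1 -> 0 <= M%:R * s <= M%:R.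
  by move=> /andP[s0 s1]; rewrite mulr_ge0 // ler_piMr.
have cH : continuous H.
  have c1 : continuous (fun st : R * R => st.1) by move=> st; exact: cvg_fst.
  have c2 : continuous (fun st : R * R => st.2) by move=> st; exact: cvg_snd.
  have cst (a : R) : continuous (fun _ : R * R => a) by move=> st; exact: cst_continuous.
  have ct (a b : R) : continuous (fun st : R * R => clamp (a * st.2 - b)).
    apply: continuous_clamp; apply: continuous_add => //.
    exact: continuous_mul.
  have ct1 : continuous (fun st : R * R => t1 st.2).
    by have := ct 3 0; under eq_fun do rewrite subr0.
  have cMs : continuous (fun st : R * R => M%:R * st.1) by exact: continuous_mul.
  apply: continuous_mix; first exact: ct.
    move=> st; apply: (@continuous_comp _ _ _ (fun st => al st.1 st.2)
      (fun s => f (clamp s))); last exact: cf'.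
    apply: continuous_add; apply: continuous_mul => //.
      by apply: continuous_add => //; exact: continuous_opp.
    apply: continuous_clamp; apply: continuous_mul => //.
    exact: continuous_add.
  apply: continuous_coordinates => v; apply: continuous_grid => //.
  by apply: continuous_mul.
exists H; split.
- exact: continuous_subspaceT.
- move=> _ [[s t] [/= s01 t01] <-]; rewrite /H /=.
  move: s01 t01; rewrite /= !mem01 => s01 t01.
  have [t13|t13] := lerP (3 * t) 1.
    by rewrite /t2 clamp0 ?mix0; [exact: fK' | lra].
  have [t23|t23] := lerP (3 * t) 2; last first.
    rewrite /t2 clamp1 ?mix1; last by lra.
    exact: grid_map_in (MP _ s01) (t3P _) qK.
  have a1 : al s t = clamp ((M%:R * s - 1) / n%:R).
    by rewrite /al /t1 clamp1 ?ltW // subrr mul0r add0r mul1r.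
  have a2 : t3 t = 0 by rewrite /t3 clamp0 ?mulr0 //; lra.
  rewrite a1 a2 clamp_id ?clamp_ge0 ?clamp_le1 //.
  pose y := f (clamp ((M%:R * s - 1) / n%:R)).
  have yK : real y by exact: fK'.
  have SK := supp_in yK.
  have [gK gS] : real (grid_map M m q (M%:R * s) 0) /\
     supp (grid_map M m q (M%:R * s) 0) \subset supp y.
    apply: grid_in => //; [exact: MP | by rewrite lexx ler0n |].
    move=> i j iu; rewrite -[0 : R]/(0%:R) => /hat_nat ->; split.
      by have [S _ /(_ false false)[]] := qK i 0%N; rewrite !addn0.
    by apply: qf iu; have /andP[] := MP _ s01.
  apply: (proj1 (mix_in Kdown SK _ yK (fintype.subxx _) gK gS)).
  by rewrite clamp_ge0 clamp_le1.
- move=> s; rewrite mem01 => s01; rewrite /H /=.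
  have -> : t2 0 = 0 by rewrite /t2 clamp0 //; lra.
  have t10 : t1 0 = 0 by rewrite /t1 clamp0 //; lra.
  by rewrite mix0 /al t10 subr0 mul0r addr0 mul1r clamp_id.
- move=> s; rewrite mem01 => s01; rewrite /H /= /t2 clamp1 ?mix1; last by lra.
  apply: grid_const => //; first exact: MP.
  move=> i j _; rewrite /t3 clamp1 ?mulr1; last by lra.
  by move=> /hat_nat ->; exact: qm.
- move=> t; rewrite mem01 => t01; rewrite /H /=; split.
    have -> : al 0 t = 0.
      rewrite /al mulr0 add0r mulr0 sub0r [clamp _]clamp0 ?mulr0 //.
      by rewrite mulNr mul1r oppr_le0 invr_ge0 ltW.
    rewrite mulr0 clamp0 // f0 (@grid_const _ _ _ _ _ _ _ x) ?mixxx ?lexx ?ler0n //.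
    by move=> i j /(@hat_nat R i 0%N) -> _; exact: q0.
  have -> : al 1 t = 1.
    rewrite /al !mulr1 [clamp (_ / _)]clamp1 ?mulr1 ?subrK //.
    by rewrite ler_pdivlMr // mul1r; lra.
  rewrite mulr1 clamp1 // f1 (@grid_const _ _ _ _ _ _ _ x) ?mixxx ?lexx ?ler0n //.
  by move=> i j /hat_nat -> _; exact: qM.
Qed.

End Realization.

(** * Sampling of maps into the realization *)

Section Sampling.
Variables (R : realType) (V : finType) (K : {set {set V}}).
Local Open Scope classical_set_scope.
Local Open Scope ring_scope.
Notation X := (prod_topology (fun _ : V => R)).
Notation real := (@geometric_realization R V K).

Lemma supp_neq0 x : real x -> exists v, v \in supp x.
Proof.
move=> [_ x1 _]; apply: contrapT => /forallNP xN.
have /eqP := x1; rewrite big1 ?(eq_sym 0) ?oner_eq0 // => v _.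
by apply/eqP; move: (xN v); rewrite inE => /negP; rewrite negbK.
Qed.

(** The open stars of the vertices cover the realization, and this is the
    Lebesgue number of the cover pulled back to the square: a whole neighbourhood
    of [z], of a radius independent of [z], is mapped into the star of one
    vertex [a]. *)
Lemma sample_square (F : R * R -> X) :
    {within `[0, 1] `*` `[0, 1], continuous F} ->
    F @` (`[0, 1] `*` `[0, 1]) `<=` real ->
  exists N, forall n, (N <= n)%N -> forall z, (`[0, 1] `*` `[0, 1])%classic z ->
    exists a, forall z', (`[0, 1] `*` `[0, 1])%classic z' ->
      `|z'.1 - z.1| <= n.+1%:R^-1 -> `|z'.2 - z.2| <= n.+1%:R^-1 -> F z' a != 0.
Proof.
set sq := _ `*` _ => cF FK.
pose P n z := exists a, forall z', sq z' ->
      `|z'.1 - z.1| <= n.+1%:R^-1 -> `|z'.2 - z.2| <= n.+1%:R^-1 -> F z' a != 0.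
have sqC : compact sq by apply: compact_setX; exact: segment_compact.
have /compact_near_coveringP/near_covering_withinP sqN := sqC.
suff : \forall n \near \oo, sq `<=` P n.
  by move=> [N _ NP]; exists N => n Nn z /(NP n Nn).
apply: sqN => z sz.
have [a az] : exists a, a \in supp (F z) by apply/supp_neq0/FK; exists z.
have ca : {within sq, continuous (fun z => F z a)}.
  exact: (@coordinate_continuous _ _ (subspace sq) F a cF).
have /subspace_continuousP/(_ _ sz) cz := ca.
have : \forall z' \near z, sq z' -> F z' a != 0.
  apply: (cz [set r : R | r != 0]).
  by apply: open_nbhs_nbhs; split; [exact: open_neq | move: az; rewrite inE].
move=> /nbhs_ballP[e /= e0 eP].
have e20 : 0 < e / 2 by rewrite divr_gt0.
exists (ball z (e / 2), [set n : nat | n.+1%:R^-1 < e / 2]) => /=.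
  split; first exact: nbhsx_ballx.
  exact: (near_infty_natSinv_lt (interval_inference.PosNum e20)).
move=> [z' n] [] [z1 z2] /= ne _; exists a => z'' sz'' d1 d2.
apply: eP => //; move: z1 z2; rewrite /ball /= => z1 z2.
have ne' : n.+1%:R^-1 < e / 2 :> R by exact: ne.
have tri (x y w : R) : `|x - y| < e / 2 -> `|w - y| <= n.+1%:R^-1 -> `|x - w| < e.
  move=> xy wy; rewrite (_ : x - w = (x - y) - (w - y)); last by ring.
  apply: le_lt_trans (ler_normB _ _) _; rewrite [e]splitr.
  exact/ltrD/(le_lt_trans wy ne').
by split; rewrite /ball /=; [apply: tri z1 d1 | apply: tri z2 d2].
Qed.

Lemma clamp_in (s : R) : `[0, 1]%classic (clamp s).
Proof. by rewrite /= in_itv /= clamp_ge0 clamp_le1. Qed.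

Lemma clamp_dist (x y : R) : `|clamp x - clamp y| <= `|x - y|.
Proof.
have wlog_le (a b : R) : a <= b -> `|clamp b - clamp a| <= `|b - a|.
  move=> ab; rewrite !ger0_norm ?subr_ge0 ?clamp_homo //.
  have [a0|a0] := lerP a 0.
    rewrite (clamp0 a0); have [b0|b0] := lerP b 0; first by rewrite (clamp0 b0); lra.
    have [b1|b1] := lerP b 1; last by rewrite clamp1; lra.
    by rewrite clamp_id; lra.
  have [a1|a1] := lerP a 1; last by rewrite !clamp1; lra.
  rewrite (@clamp_id _ a); last by lra.
  have [b1|b1] := lerP b 1; last by rewrite clamp1; lra.
  by rewrite clamp_id; lra.
have /orP[xy|yx] := le_total x y; last exact: wlog_le.
by rewrite distrC (distrC x); exact: wlog_le.
Qed.

Lemma sample_path (f : R -> X) :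
    {within `[0, 1], continuous f} -> f @` `[0, 1] `<=` real ->
  exists N, forall n, (N <= n)%N -> forall s, exists a, forall s',
    `|s' - s| <= n.+1%:R^-1 -> f (clamp s') a != 0.
Proof.
move=> cf fK.
have [||N NP] := @sample_square (fun st => f (clamp st.1)).
- apply: continuous_subspaceT.
  apply: (@continuous_comp_within _ _ _ _ (fun st => clamp st.1) f cf) => [|st].
    by apply: continuous_clamp => st; exact: cvg_fst.
  exact: clamp_in.
- by move=> _ [st _ <-]; apply: fK; exists (clamp st.1) => //; exact: clamp_in.
exists N => n /NP nP s.
have [|a aP] := nP (clamp s, 0).
  by split=> /=; rewrite in_itv /= ?clamp_ge0 ?clamp_le1 ?lexx ?ler01.
exists a => s' ss'; have := aP (clamp s', 0).
rewrite /= (clamp_id (x := clamp s')) ?clamp_ge0 ?clamp_le1 //; apply.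
- by split=> /=; rewrite in_itv /= ?clamp_ge0 ?clamp_le1 ?lexx ?ler01.
- exact: le_trans (clamp_dist _ _) ss'.
- by rewrite subrr normr0 invr_ge0 ler0n.
Qed.

End Sampling.

(** * Edge-simple connectedness implies simple connectedness *)

Section EdgeToTopology.
Variables (R : realType) (V : finType) (K : {set {set V}}).
Local Open Scope classical_set_scope.
Local Open Scope ring_scope.
Notation X := (prod_topology (fun _ : V => R)).
Notation real := (@geometric_realization R V K).
Hypothesis Kdown : down_closed K.

Lemma supp_vertex_in (x : X) v : real x -> v \in supp x -> [set v]%SET \in K.
Proof.
move=> /supp_in xK vx; rewrite -[[set v]%SET]setUid; exact: (face2 Kdown xK vx vx).
Qed.

Lemma supp_vertex_sub (x : X) (v : V) : v \in supp x -> supp (vertex R v) \subset supp x.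
Proof. by move=> vx; rewrite supp_vertex sub1set. Qed.

(** The path interpolates the sequence that starts at [x], runs through the
    vertices of the edge path and ends at [y]. *)
Lemma edge_path_connected (x y : X) a s : real x -> real y ->
    a \in supp x -> path (adjacent K) a s -> last a s \in supp y ->
  exists f : R -> X, path_in real f x y.
Proof.
move=> xK yK ax aP ay; pose M := (size s).+2.
have aK := supp_vertex_in xK ax.
have pP := path_edge_path Kdown aK aP.
have adjP i := @edge_path_pad _ K a (a :: s) i isT pP.
have padV i : [set pad a (a :: s) i]%SET \in K by have [] := vertex_adjacent Kdown (adjP i).
pose q i (j : nat) : X :=
  if i is i'.+1 then if (M <= i)%N then y else vertex R (pad a (a :: s) i') else x.
have qK i j : common_simplex K q i j.
  have [->|i0] := posnP i.
    exists (supp x); first exact: supp_in.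
    case=> b; rewrite /q /= ?addn0 ?addn1; split=> //; first exact: vertex_in.
    exact: supp_vertex_sub.
  have [iM|Mi] := ltnP i.+1 M.
    exists [set pad a (a :: s) i.-1; pad a (a :: s) i]%SET.
      by have := adjP i.-1; rewrite prednK.
    case: i i0 iM => // i _ iM [] b; rewrite /q ?addn0 ?addn1.
      rewrite leqNgt iM /=; split; first exact: vertex_in.
      by rewrite supp_vertex sub1set !inE eqxx orbT.
    rewrite leqNgt (ltnW iM) /=; split; first exact: vertex_in.
    by rewrite supp_vertex sub1set !inE eqxx.
  exists (supp y); first exact: supp_in.
  case: i i0 Mi => // i _ Mi [] b; rewrite /q ?addn0 ?addn1 ?Mi //.
  case: ifP => // _; split; first exact: vertex_in.
  by apply: supp_vertex_sub; rewrite pad_size.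
exists (fun s : R => grid_map M 0 q (M%:R * s) 0); split.
- apply: continuous_subspaceT; apply: continuous_coordinates => v.
  by apply: continuous_grid => u; [apply: continuous_mul => {}u;
    [exact: cst_continuous|exact: cvg_id] | exact: cst_continuous].
- move=> _ [u /= u01 <-]; apply: grid_map_in => //; last by rewrite lexx.
  move: u01; rewrite in_itv /= => /andP[u0 u1].
  by rewrite mulr_ge0 // ler_piMr.
- rewrite mulr0; apply: grid_const; rewrite ?lexx ?ler0n // => i j.
  by move=> /(@hat_nat R i 0%N) ->.
- rewrite mulr1; apply: grid_const; rewrite ?lexx ?ler0n // => i j.
  by move=> /hat_nat -> _; rewrite /q leqnn.
Qed.

Hypothesis Ksc : edge_simply_connected K.

(** The loop is sampled at [n.+1] points, where it is replaced by the vertex of a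
    star; the resulting edge loop is contracted combinatorially, and the rows of
    that contraction, with [x] put around them, form the grid of
    [null_homotopic_grid]. *)
Lemma loop_null_homotopic (x : X) (f : R -> X) :
  real x -> path_in real f x x -> null_homotopic real f x.
Proof.
move=> xK fP; have [cf fK f0 f1] := fP.
have [N /(_ N (leqnn N))] := sample_path cf fK; set n := N.+1 => NP.
have n0 : (0 : R) < n%:R by rewrite ltr0n.
have [v vP] : exists v : nat -> V, forall i s, `|s - i%:R / n%:R| <= n%:R^-1 ->
    v i \in supp (f (clamp s)).
  have [v vP] := choice (fun i : nat => NP (i%:R / n%:R)).
  by exists v => i s /vP; rewrite inE.
have fK' s : supp (f (clamp s)) \in K.
  by apply: supp_in; apply: fK; exists (clamp s) => //; exact: clamp_in.
have ninv : (0 : R) <= n%:R^-1 by rewrite invr_ge0 ltW.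
have vv i : v i \in supp (f (clamp (i%:R / n%:R))).
  by apply: vP; rewrite subrr normr0.
have vvS i : v i.+1 \in supp (f (clamp (i%:R / n%:R))).
  apply: vP; rewrite -mulrBl -natr1 opprD addrA subrr sub0r mulN1r normrN.
  by rewrite ger0_norm.
have v0x : v 0%N \in supp x by have := vv 0%N; rewrite mul0r clamp0 ?f0.
have vnx : v n \in supp x by have := vv n; rewrite divff ?gt_eqF // clamp1 ?f1.
set u := v 0%N in v0x.
pose w i := if (i <= n)%N then v i else u.
have wu i : (n < i)%N -> w i = u by rewrite /w ltnNge => /negPf ->.
have wP i : adjacent K (w i) (w i.+1).
  rewrite /w; case: (ltngtP i n) => [iltn|ni|->].
  - exact: (face2 Kdown (fK' _) (vv i) (vvS i)).
  - exact: (face2 Kdown (supp_in xK) v0x v0x).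
  - exact: (face2 Kdown (supp_in xK) vnx v0x).
have uK := supp_vertex_in xK v0x.
have [_ _ /(_ u (mkseq (fun i => w i.+1) n.+1) uK)] := Ksc.
have pathw : path (adjacent K) u (mkseq (fun i => w i.+1) n.+1).
  apply/(pathP u) => i; rewrite size_mkseq => ilt.
  rewrite nth_mkseq //; have := wP i; congr (adjacent K _ _).
  by case: i ilt => //= i ilt; rewrite nth_mkseq // ltnW.
have lastw : last u (mkseq (fun i => w i.+1) n.+1) = u.
  by rewrite -[n.+1]addn1 /mkseq iotaD map_cat last_cat add0n; exact: wu.
move=> /(_ pathw lastw) /(edge_homotopic_grid Kdown u) /(_ isT).
move=> /(_ (path_edge_path Kdown uK pathw)).
move=> [m [N' [r [r0 rm rS rl rN]]]].
have padw i : pad u (u :: mkseq (fun i => w i.+1) n.+1) i = w i.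
  have [ni|ilt] := ltnP n.+1 i.
    rewrite pad_size; first by rewrite (wu _ (ltnW ni)); exact: lastw.
    change (size (mkseq (fun i => w i.+1) n.+1) < i.+1)%N.
    by rewrite size_mkseq leqW.
  case: i ilt => // i ilt; rewrite /pad.
  change (nth (last u (mkseq (fun i => w i.+1) n.+1))
              (mkseq (fun i => w i.+1) n.+1) i = w i.+1).
  by rewrite nth_mkseq.
have padu i : pad u [:: u] i = u by rewrite pad_size.
have {}r0 i : r 0%N i = w i by rewrite r0 padw.
have {}rm i : r m i = u by rewrite rm padu.
pose L := maxn N' n.+1.
have {}rN i j : (j <= m)%N -> (L <= i)%N -> r j i = u.
  by move=> jm; rewrite geq_max => /andP[Ni ni]; rewrite rN // padw wu.
have {}rl j : (j <= m)%N -> r j 0%N = u by move=> /rl ->.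
(* The node [x] is put in front of each row, whence the shift [i.-1]; it also
   closes the rows from column [L.+2] on and forms the row [m.+1]. *)
pose q i j : X := if [|| i == 0%N, (L.+2 <= i)%N | (m < j)%N] then x
                  else vertex R (r j i.-1).
(* Next to the boundary all nodes are [x] or the vertex [u], which belongs to
   the support of [x]; elsewhere the squares are those of the rows [r]. *)
have nearx i j : [|| (i <= 1)%N, (L < i)%N | (m <= j)%N] ->
    real (q i j) /\ supp (q i j) \subset supp x.
  rewrite /q; case: ifP => // /negbT; rewrite !negb_or -!leqNgt => /and3P[i0 iL jm].
  move=> H; suff -> : r j i.-1 = u.
    by split; [exact: vertex_in | exact: supp_vertex_sub].
  case/or3P: H => [i1|Li|mj].
  - by rewrite (_ : i.-1 = 0%N) ?rl //; case: (i) i1 => // -[].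
  - by apply: rN => //; case: (i) i0 Li.
  - by rewrite (_ : j = m) //; apply/eqP; rewrite eqn_leq jm.
have qK i j : common_simplex K q i j.
  have [H|] := boolP [|| i == 0%N, (L < i)%N | (m <= j)%N].
    exists (supp x); first exact: supp_in.
    by move=> a b; apply: nearx; clear -H; case: a; case: b; lia.
  rewrite !negb_or -!ltnNge => /and3P[i0 iL jm].
  exists [set r j i.-1; r j i.-1.+1; r j.+1 i.-1; r j.+1 i.-1.+1]%SET.
    exact: rS.
  move=> a b; rewrite /q ifF; last by clear -i0 iL jm; case: a; case: b; lia.
  have cellr : r (j + b)%N (i + a).-1 \in
      [set r j i.-1; r j i.-1.+1; r j.+1 i.-1; r j.+1 i.-1.+1]%SET.
    rewrite prednK ?lt0n //.
    by case: a; case: b; rewrite ?addn0 ?addn1 !inE eqxx ?orbT.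
  split; last by rewrite supp_vertex sub1set.
  apply: vertex_in; rewrite -[[set _]%SET]setUid.
  exact: (face2 Kdown (rS _ jm i.-1) cellr cellr).
apply: (@null_homotopic_grid _ _ _ Kdown x f n L.+2 m.+1 q) => //.
- by rewrite /L; lia.
- by move=> i j Li; rewrite /q Li orbT.
- by move=> i j mj; rewrite /q mj !orbT.
move=> t i t0 it; rewrite /q ltn0 orbF; have [i1 i2] := hat_neq0 it.
have low : t <= 1 -> supp x \subset supp (f (clamp ((t - 1) / n%:R))).
  by move=> t1; rewrite clamp0 ?f0 // pmulr_lle0 ?invr_gt0 // subr_le0.
have high : n.+1%:R <= t -> supp x \subset supp (f (clamp ((t - 1) / n%:R))).
  by move=> t1; rewrite clamp1 ?f1 // ler_pdivlMr // mul1r lerBrDr natr1.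
case: ifP => [/orP[/eqP i0|Li]|/negbT].
- by apply: low; move: i2; rewrite i0 add0r => /ltW.
- apply: high; apply: le_trans (ltW i1); rewrite lerBrDr natr1 ler_nat.
  by rewrite /L in Li; clear -Li; lia.
rewrite negb_or => /andP[i0 _]; rewrite r0 supp_vertex sub1set /w.
case: ifP => [_|/negbT].
  apply: vP; rewrite -mulrBl normrM (ger0_norm ninv) ler_piMl // ler_norml.
  by move: i1 i2; rewrite -(prednK (n := i)) ?lt0n // -natr1 /=; lra.
move=> ni; apply: (subsetP (high _)) v0x.
apply: le_trans (ltW i1); rewrite lerBrDr natr1 ler_nat.
by clear -ni i0; lia.
Qed.

Lemma edge_simply_connected_realization : simply_connected R real.
Proof.
have [[v vK] conn _] := Ksc; split.
- by exists (vertex R v); exact: vertex_in.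
- move=> x y xK yK; have [[a ax] [b b_y]] := (supp_neq0 xK, supp_neq0 yK).
  have [s sP sl] := conn a b (supp_vertex_in xK ax) (supp_vertex_in yK b_y).
  by apply: (@edge_path_connected x y a s) => //; rewrite sl.
- by move=> x f xK; exact: loop_null_homotopic.
Qed.

End EdgeToTopology.

(** * Simple connectedness implies edge-simple connectedness *)

Section TopologyToEdge.
Variables (R : realType) (V : finType) (K : {set {set V}}).

Lemma edge_nseq c (u : V) : edge_homotopic K (nseq c.+1 u) [:: u].
Proof.
elim: c => [|c IHc]; first exact: rew_refl.
apply: rew_trans (edge_repeat K u).
exact: (rew_cons u IHc).
Qed.

Lemma edge_repeats c (w : nat -> V) l :
  edge_homotopic K (mkseq (fun i => w (i %/ c.+1)) (c.+1 * l)) (mkseq w l).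
Proof.
elim: l => [|l IHl]; first by rewrite muln0; exact: rew_refl.
rewrite mulnS addnC mkseqS /mkseq iotaD map_cat -cats1 add0n.
apply: rew_cat IHl _.
suff -> : [seq w (i %/ c.+1) | i <- iota (c.+1 * l) c.+1] = nseq c.+1 (w l).
  exact: edge_nseq.
apply: (@eq_from_nth _ (w l)); rewrite size_map size_iota ?size_nseq // => i ic.
rewrite (nth_map 0) ?size_iota // nth_iota // nth_nseq ic.
by rewrite mulnC divnMDl // divn_small // addn0.
Qed.

Local Open Scope classical_set_scope.
Local Open Scope ring_scope.
Notation X := (prod_topology (fun _ : V => R)).
Notation real := (@geometric_realization R V K).
Hypothesis Kdown : down_closed K.

(** A path in the realization runs through the stars of finitely many vertices;
    at the ends these vertices must be [u] and [v], because the support of a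
    vertex is a singleton. *)
Lemma edge_connected (f : R -> X) u v : [set u]%SET \in K ->
  path_in real f (vertex R u) (vertex R v) ->
  exists2 s, path (adjacent K) u s & last u s = v.
Proof.
move=> uK [cf fK f0 f1].
have [N /(_ N (leqnn N))] := sample_path cf fK; set n := N.+1 => NP.
have n0 : (0 : R) < n%:R by rewrite ltr0n.
have [a aP] := choice (fun i : nat => NP (i%:R / n%:R)).
have ninv : (0 : R) <= n%:R^-1 by rewrite invr_ge0 ltW.
have fK' s : supp (f (clamp s)) \in K.
  by apply: supp_in; apply: fK; exists (clamp s) => //; exact: clamp_in.
have aa i : a i \in supp (f (clamp (i%:R / n%:R))).
  by rewrite inE; apply: aP; rewrite subrr normr0.
have aaS i : a i.+1 \in supp (f (clamp (i%:R / n%:R))).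
  rewrite inE; apply: aP; rewrite -mulrBl -natr1 opprD addrA subrr sub0r mulN1r.
  by rewrite normrN ger0_norm.
have a0 : a 0%N = u.
  by have := aa 0%N; rewrite mul0r clamp0 // f0 supp_vertex inE => /eqP.
have an : a n = v.
  by have := aa n; rewrite divff ?gt_eqF // clamp1 // f1 supp_vertex inE => /eqP.
exists (mkseq (fun i => a i.+1) n).
  apply/(pathP u) => i; rewrite size_mkseq => ilt; rewrite nth_mkseq //.
  have := face2 Kdown (fK' _) (aa i) (aaS i); congr (adjacent K _ _).
  by case: i ilt => //= i ilt; rewrite nth_mkseq // ltnW.
by rewrite /n mkseqS last_rcons.
Qed.

(** The piecewise linear path through [w 0, .., w L], run through in time 1. *)
Definition edge_loop L (w : nat -> V) (t : R) : X :=
  grid_map L 0 (fun i _ => vertex R (w i)) (L%:R * t) 0.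

Lemma supp_edge_loop L (w : nat -> V) k (t : R) :
    (forall i, adjacent K (w i) (w i.+1)) -> 0 <= t <= 1 ->
    k%:R <= L%:R * t <= k.+1%:R ->
  supp (edge_loop L w t) \subset [set w k; w k.+1]%SET.
Proof.
move=> wP /andP[t0 t1] /andP[kt tk].
have wV i : [set w i]%SET \in K by have [] := vertex_adjacent Kdown (wP i).
apply: (proj2 (grid_in Kdown _ _ (wP k) _)).
- by rewrite mulr_ge0 // ler_piMr.
- by rewrite lexx.
move=> i j it _; split; first exact: vertex_in.
rewrite supp_vertex sub1set !inE; have [i1 i2] := hat_neq0 it.
have : (k%:R < i.+1%:R :> R) by rewrite -natr1; lra.
have : (i%:R < k.+2%:R :> R) by rewrite -(natr1 k.+1); lra.
rewrite !ltr_nat !ltnS leq_eqVlt => /predU1P[->|]; first by rewrite eqxx orbT.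
by move=> ik ki; rewrite (_ : i = k) ?eqxx //; lia.
Qed.

Lemma edge_loop_ends L (w : nat -> V) :
  edge_loop L w 0 = vertex R (w 0%N) /\ edge_loop L w 1 = vertex R (w L).
Proof.
rewrite /edge_loop mulr0 mulr1; split; apply: grid_const; rewrite ?lexx ?ler0n //.
  by move=> i j /(@hat_nat R i 0%N) ->.
by move=> i j /hat_nat ->.
Qed.

(** With [c] sample points on each edge, the vertices that can be chosen at the
    sample points [i] and [i.+1] are ends of the edge number [i %/ c]. *)
Lemma sample_edge_loop L c (w : nat -> V) i (z : V) :
    (forall i, adjacent K (w i) (w i.+1)) -> (forall i, (L <= i)%N -> w i = w L) ->
    (0 < L)%N -> (0 < c)%N ->
    z \in supp (edge_loop L w (clamp (i%:R / (c * L)%:R))) \/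
    z \in supp (edge_loop L w (clamp (i.+1%:R / (c * L)%:R))) ->
  z \in [set w (i %/ c)%N; w (i %/ c).+1]%SET.
Proof.
move=> wP wL L0 c0.
have LR : (0 : R) < L%:R by rewrite ltr0n.
have cR : (0 : R) < c%:R by rewrite ltr0n.
have cLR : (0 : R) < (c * L)%:R by rewrite natrM mulr_gt0.
have end1 j : (c * L <= j)%N -> clamp (j%:R / (c * L)%:R) = 1 :> R.
  by move=> cj; rewrite clamp1 // ler_pdivlMr // mul1r ler_nat.
have [ci|ic] := leqP (c * L) i.
  rewrite !end1 ?(leqW ci) // (edge_loop_ends _ _).2 supp_vertex !inE wL.
    by case=> ->.
  by rewrite leq_divRL // mulnC.
have mid j : (i <= j <= i.+1)%N ->
    supp (edge_loop L w (clamp (j%:R / (c * L)%:R))) \subset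
      [set w (i %/ c)%N; w (i %/ c).+1]%SET.
  move=> /andP[ij ji]; have j01 : 0 <= (j%:R / (c * L)%:R : R) <= 1.
    rewrite divr_ge0 //= ler_pdivrMr // mul1r ler_nat.
    exact: leq_trans ji ic.
  rewrite clamp_id //; apply: supp_edge_loop => //.
  have -> : L%:R * (j%:R / (c * L)%:R) = j%:R / c%:R :> R.
    by rewrite natrM; field; rewrite !gt_eqF.
  rewrite ler_pdivlMr // ler_pdivrMr // -!natrM !ler_nat.
  rewrite (leq_trans (leq_trunc_div i c) ij) /= (leq_trans ji) //.
  by rewrite ltn_ceil.
by case; apply/subsetP/mid; rewrite ?leqnn ?leqnSn.
Qed.

(** A null homotopy [H] of the piecewise linear loop of an edge path is sampled
    on a grid fine enough for [sample_square].  Vertices chosen at the corners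
    of a small square have a common point in their stars, so they span a
    simplex: consecutive rows are contiguous, and the top row is constant. *)
Lemma simply_connected_edge : simply_connected R real -> edge_simply_connected K.
Proof.
move=> [[x0 x0K] conn null]; split.
- have [v vx] := supp_neq0 x0K; exists v.
  by rewrite -[[set v]%SET]setUid; exact: (face2 Kdown (supp_in x0K) vx vx).
- move=> u v uK vK.
  have [f fP] := conn _ _ (vertex_in R uK) (vertex_in R vK).
  exact: edge_connected uK fP.
move=> u s uK us lastu; pose L := (size s).+1.
pose w := pad u (u :: s).
have wP i : adjacent K (w i) (w i.+1).
  by apply: edge_path_pad => //; exact: (path_edge_path Kdown uK us).
have wu i : (L <= i.+1)%N -> w i = u by move=> Li; rewrite /w pad_size.
have wL i : (L <= i)%N -> w i = w L by move=> Li; rewrite !wu // leqW.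
have [f0 f1] := edge_loop_ends L w.
have w0 : w 0%N = u by [].
have wLu : w L = u by rewrite wu.
have uV := vertex_in R uK.
have fK t : 0 <= t <= 1 -> real (edge_loop L w t).
  move=> /andP[t0 t1]; apply: grid_map_in => //; rewrite ?lexx ?ler0n //.
    by rewrite mulr_ge0 // ler_piMr.
  move=> i j; exists [set w i; w i.+1]%SET; first exact: wP.
  move=> a b; have := vertex_adjacent Kdown (wP (i + a)%N) => -[wV _].
  split; first exact: vertex_in.
  by rewrite supp_vertex sub1set; case: a {wV}; rewrite ?addn0 ?addn1 !inE eqxx ?orbT.
have loopP : path_in real (edge_loop L w) (vertex R u) (vertex R u).
  split=> //; last by rewrite f1 wLu.
    apply: continuous_subspaceT; apply: continuous_coordinates => v.
    by apply: continuous_grid => t; [apply: continuous_mul => {}t;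
      [exact: cst_continuous|exact: cvg_id] | exact: cst_continuous].
  by move=> _ [t /= t01 <-]; apply: fK; move: t01; rewrite in_itv.
have [H [cH HK H0 H1 HS]] := null _ _ uV loopP.
have [N NP] := sample_square cH HK.
(* The mesh is a multiple of [L], so that the sample points subdivide the edges
   of the loop. *)
pose c := N.+1; pose S := (c * L)%N.
have S0 : (0 < S)%N by rewrite muln_gt0.
have SN : (N <= S.-1)%N by rewrite -ltnS prednK // leq_pmulr.
have {NP} := NP _ SN; rewrite prednK // => NP.
pose pt (ij : nat * nat) : R * R := (clamp (ij.1%:R / S%:R), clamp (ij.2%:R / S%:R)).
have ptP ij : (`[0, 1] `*` `[0, 1])%classic (pt ij) by split; exact: clamp_in.
have [a aP] := choice (fun ij => NP (pt ij) (ptP ij)).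
have SR : (0 : R) < S%:R by rewrite ltr0n.
have step i (b : bool) :
    `|clamp (i%:R / S%:R) - clamp ((i + b)%:R / S%:R)| <= S%:R^-1 :> R.
  apply: le_trans (clamp_dist _ _) _; rewrite -mulrBl normrM normfV.
  rewrite (ger0_norm (ltW SR)) ler_piMl ?invr_ge0 ?ler0n // natrD opprD addrA.
  by rewrite subrr sub0r normrN; case: b; rewrite ?normr1 ?normr0.
have aS i j (b b' : bool) : a ((i + b)%N, (j + b')%N) \in supp (H (pt (i, j))).
  by rewrite inE; apply: aP; [exact: ptP | exact: step | exact: step].
have HS' ij : supp (H (pt ij)) \in K.
  by apply: supp_in; apply: HK; exists (pt ij) => //; exact: ptP.
have aC j : contiguous K (fun i => a (i, j)) (fun i => a (i, j.+1)).
  move=> i; have := (aS i j false false, aS i j true false).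
  have := (aS i j false true, aS i j true true); rewrite !addn0 !addn1.
  by move=> [h1 h2] [h3 h4]; exact: (face4 Kdown (HS' (i, j))).
have au ij : H (pt ij) = vertex R u -> a ij = u.
  case: ij => i j Hu; have := aS i j false false; rewrite Hu supp_vertex inE !addn0.
  by move/eqP.
have end1 j : (S <= j)%N -> clamp (j%:R / S%:R) = 1 :> R.
  by move=> cj; rewrite clamp1 // ler_pdivlMr // mul1r ler_nat.
have c01 t : clamp t \in (`[0, 1] : interval R) by rewrite in_itv /= clamp_ge0 clamp_le1.
have a0 j : a (0%N, j) = u.
  by apply: au; rewrite /pt /= mul0r (clamp0 (lexx _)); have [] := HS _ (c01 (j%:R / S%:R)).
have aSu j : a (S, j) = u.
  by apply: au; rewrite /pt /= end1 //; have [] := HS _ (c01 (j%:R / S%:R)).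
have atop i : a (i, S) = u by apply: au; rewrite /pt /= (end1 S) // H1.
have rows j : edge_homotopic K (mkseq (fun i => a (i, 0%N)) S.+1)
    (mkseq (fun i => a (i, j)) S.+1).
  elim: j => [|j IHj]; first exact: rew_refl.
  by apply: rew_trans IHj (contiguous_homotopic Kdown (aC j) _ _); rewrite ?a0 ?aSu.
(* The vertices sampled on the loop itself need not follow the loop, but they
   are contiguous to the loop with each vertex repeated [c] times. *)
have bottom : contiguous K (fun i => w (i %/ c)%N) (fun i => a (i, 0%N)).
  move=> i; have aw k : k = i \/ k = i.+1 ->
      a (k, 0%N) \in [set w (i %/ c)%N; w (i %/ c).+1]%SET.
    move=> ki; apply: (@sample_edge_loop L c) => //.
    have := aS k 0%N false false; rewrite /pt /= !addn0 mul0r (clamp0 (lexx _)).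
    by rewrite H0 //; case: ki => ->; [left | right].
  have [ai ai'] := (aw i (or_introl erefl), aw i.+1 (or_intror erefl)).
  apply: (face4 Kdown (wP (i %/ c)%N) _ _ ai ai'); first by rewrite !inE eqxx.
  by rewrite divnS //; case: (_ %| _)%N; rewrite ?add1n ?add0n !inE eqxx ?orbT.
have botS : w (S %/ c)%N = u by rewrite /S mulKn.
apply: (rew_trans (mkseq (fun i => w (i %/ c)%N) S.+1)).
  apply: rew_sym; rewrite mkseqS botS -cats1.
  apply: (rew_trans ((u :: s) ++ [:: u])).
    apply: rew_cat (rew_refl _ _).
    by have := edge_repeats N w L; rewrite -[mkseq w L]/(mkseq w (size (u :: s))) mkseq_nth.
  rewrite lastI lastu cat_rcons -cats1.
  exact: rew_cat (rew_refl _ _) (edge_repeat _ _).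
apply: rew_trans (contiguous_homotopic Kdown bottom _ _) _; rewrite ?a0 ?aSu ?botS ?div0n //.
apply: rew_trans (rows S) _.
have -> : mkseq (fun i => a (i, S)) S.+1 = nseq S.+1 u.
  apply: (@eq_from_nth _ u); rewrite size_mkseq ?size_nseq // => i iS.
  by rewrite nth_mkseq // nth_nseq iS atop.
exact: edge_nseq.
Qed.

End TopologyToEdge.

(** * Words in fixed points of a coprime action *)

Section Words.
Variable gT : finGroupType.
Implicit Types (K B : {group gT}) (b x y h : gT) (w : seq gT).
Import GroupScope.
Local Open Scope group_scope.

Definition letter K B x := [exists b in B^#, x \in 'C_K[b]].

Inductive word_step K B : seq gT -> seq gT -> Prop :=
| word_mul b x y : b \in B^# -> x \in 'C_K[b] -> y \in 'C_K[b] ->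
    word_step K B [:: x; y] [:: x * y]
| word_one : word_step K B [:: 1] [::].

Definition word_equiv K B := rewrites (word_step K B).

(** Every relation between elements of the subgroups ['C_K[b]] is a consequence of
    relations inside a single ['C_K[b]].  If these subgroups generate [K], then
    [K] is the colimit of the system formed by them and their intersections.
    Stating this with words avoids the construction of the colimit, which might
    be an infinite group. *)
Definition amalgam K B :=
  forall w, all (letter K B) w -> \prod_(x <- w) x = 1 -> word_equiv K B w [::].

Lemma letterP K B x : reflect (exists2 b, b \in B^# & x \in 'C_K[b]) (letter K B x).
Proof.
apply: (iffP existsP) => [[b /andP[bB xb]]|[b bB xb]]; exists b => //.
by rewrite bB.
Qed.

Lemma letter_in K B x : letter K B x -> x \in K.
Proof. by case/letterP => b _ /setIP[]. Qed.

Lemma word_equiv_mul K B b x y : b \in B^# -> x \in 'C_K[b] -> y \in 'C_K[b] ->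
  word_equiv K B [:: x; y] [:: x * y].
Proof. by move=> bB xb yb; apply: rew1; exact: word_mul bB xb yb. Qed.

Lemma word_equiv_one K B : word_equiv K B [:: 1] [::].
Proof. by apply: rew1; exact: word_one. Qed.

Lemma word_equiv_prod K B w w' :
  word_equiv K B w w' -> \prod_(x <- w) x = \prod_(x <- w') x.
Proof.
elim=> {w w'} [p q s t st|//|s t _ ->|s t u _ -> _ ->] //.
rewrite !big_cat /=; congr (_ * (_ * _)); case: st => [b x y _ _ _|].
  by rewrite !big_cons !big_nil !mulg1.
by rewrite big_cons !big_nil mulg1.
Qed.

(** The empty word consists of letters and is equivalent to [[:: 1]]; hence the
    need for some [b] in [B^#]. *)
Lemma word_equiv_letters K B w w' : (1 < #|B|)%N -> word_equiv K B w w' ->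
  all (letter K B) w = all (letter K B) w'.
Proof.
rewrite cardG_gt1 => /trivgPn[b0 Bb0 b01].
elim=> {w w'} [p q s t st|//|s t _ ->|s t u _ -> _ ->] //.
rewrite !all_cat; congr (_ && (_ && _)); case: st => [b x y bB xb yb|] /=.
  have ltr z : z \in 'C_K[b] -> letter K B z by move=> zb; apply/letterP; exists b.
  by rewrite !ltr // groupM.
rewrite andbT; apply/letterP; exists b0; last exact: group1.
by rewrite !inE b01.
Qed.

End Words.

Section ElementaryAbelianPoset.
Variables (gT : finGroupType) (p : nat) (G : {group gT}).
Import GroupScope.
Local Open Scope group_scope.

Definition Ap_complex :=
  order_complex (fun E F : {group gT} => E \subset F) (elementary_abelian_poset p G).

Lemma Ap_down_closed : down_closed Ap_complex.
Proof.
move=> c d; rewrite !inE => /and3P[_ cP /forall_inP cc] dc d0.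
rewrite d0 (subset_trans dc cP); apply/forall_inP => x xd; apply/forall_inP => y yd.
by have /forall_inP := cc x (subsetP dc x xd); apply; exact: (subsetP dc).
Qed.

Lemma Ap_vertex (E : {group gT}) :
  ([set E]%SET \in Ap_complex) = (E \in elementary_abelian_poset p G).
Proof.
rewrite inE sub1set; apply/and3P/idP => [[]//|EP]; split=> //.
  by apply/set0Pn; exists E; rewrite inE.
by apply/forall_inP => x /set1P->; apply/forall_inP => y /set1P->; rewrite subxx.
Qed.

Lemma Ap_chain (E F H : {group gT}) :
    E \in elementary_abelian_poset p G -> F \in elementary_abelian_poset p G ->
    H \in elementary_abelian_poset p G -> E \subset F -> F \subset H ->
  [set E; F; H]%SET \in Ap_complex.
Proof.
move=> EP FP HP EF FH; have EH := subset_trans EF FH.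
rewrite inE !subUset !sub1set EP FP HP; apply/and3P; split=> //.
  by apply/set0Pn; exists E; rewrite !inE eqxx.
apply/forall_inP => x; rewrite !inE => /orP[/orP[]|] /eqP->;
  apply/forall_inP => y; rewrite !inE => /orP[/orP[]|] /eqP->;
  by rewrite ?subxx ?EF ?FH ?EH ?orbT.
Qed.

(** A simplex is a chain of nontrivial subgroups, so its least member is
    contained in all of them. *)
Lemma Ap_meet (c : {set {group gT}}) : c \in Ap_complex ->
  exists2 e, e != 1 & forall E, E \in c -> e \in E.
Proof.
rewrite inE => /and3P[/set0Pn[E0 E0c] /subsetP cP /forall_inP cc].
have [E Ec Emin] := arg_minnP (fun E : {group gT} => #|E|) E0c.
have := cP E Ec; rewrite !inE => /andP[/trivgPn[e eE e1] _].
exists e => // F Fc; have /forall_inP/(_ F Fc) := cc E Ec.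
case/orP => [/subsetP->//|FE].
by have /eqP -> : F :==: E by rewrite eqEcard FE Emin.
Qed.

End ElementaryAbelianPoset.

(** * Edge paths of elementary abelian subgroups as words *)

Section Sylow.
Variables (gT : finGroupType) (p : nat) (K B G : {group gT}).
Import GroupScope.
Local Open Scope group_scope.

Lemma coprime_complement_Sylow :
    p.-group B -> p^'.-group K -> K * B = G -> p.-Sylow(G) B.
Proof.
move=> pB p'K defG; have coKB : coprime #|K| #|B|.
  by rewrite coprime_sym (pnat_coprime pB).
rewrite pHallE -{1}defG mulG_subr /= -defG coprime_cardMg // partnM ?cardG_gt0 //.
by rewrite part_p'nat // mul1n part_pnat_id.
Qed.

End Sylow.

Section PathsAndWords.
Variables (gT : finGroupType) (p : nat) (K B G : {group gT}).
Import GroupScope.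
Local Open Scope group_scope.
Hypotheses (abelB : p.-abelem B) (B1 : B :!=: 1)
  (p'K : p^'.-group K) (nKB : B \subset 'N(K)) (defG : K * B = G).
Notation P := (elementary_abelian_poset p G).
Notation oc := (Ap_complex p G).
Implicit Types (E F : {group gT}) (h x : gT).

Let pB : p.-group B. Proof. exact: abelem_pgroup abelB. Qed.

Let coKB : coprime #|K| #|B|.
Proof. by rewrite coprime_sym (pnat_coprime pB). Qed.

Let sBG : B \subset G. Proof. by rewrite -defG mulG_subr. Qed.
Let sKG : K \subset G. Proof. by rewrite -defG mulG_subl. Qed.

Let sylB : p.-Sylow(G) B.
Proof. exact: coprime_complement_Sylow defG. Qed.

Lemma Ap_sub E F : E \in P -> F \subset E -> F :!=: 1 -> F \in P.
Proof.
rewrite !inE => /and3P[_ sEG abelE] FE F1.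
by rewrite (subset_trans FE sEG) (abelemS FE abelE) -val_eqE F1.
Qed.

Lemma conj_Ap E h : h \in K -> E \subset B -> E :!=: 1 -> (E :^ h^-1)%G \in P.
Proof.
move=> hK EB E1; have hG := subsetP sKG h hK.
rewrite !inE abelemJ (abelemS EB abelB) andbT; apply/andP; split.
  apply: contra_neq E1 => /(congr1 val) /= Eh.
  by rewrite -(conjsgK h^-1 E) Eh conjs1g.
by rewrite -(conjGid (groupVr hG)) conjSg (subset_trans EB sBG).
Qed.

(** A choice of [h] in [K] with [E] in [B :^ h^-1].  Such [h] form one coset of
    ['C_K(E :^ h)], by [label_diff]; the choice turns cosets into elements. *)
Definition label E := odflt 1 [pick h in K | E :^ h \subset B].

Lemma labelP E : E \in P -> label E \in K /\ E :^ label E \subset B.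
Proof.
rewrite !inE => /and3P[E1 sEG abelE]; rewrite /label.
case: pickP => [h /andP[]//|noh].
have [g] := Sylow_Jsub sylB sEG (abelem_pgroup abelE).
rewrite -defG => /mulsgP[k b kK bB ->] sEB.
have := noh k; rewrite kK /= => /negP[].
by rewrite -(conjSg _ _ b) -conjsgM (conjGid bB).
Qed.

(** Modulo [K] the elements [e ^ h] and [e ^ h'] of [B] are equal, and [B] meets [K]
    trivially: they are equal, so [h^-1 * h'] commutes with them. *)
Lemma label_diff e h h' : h \in K -> h' \in K -> e ^ h \in B -> e ^ h' \in B ->
  h^-1 * h' \in 'C_K[e ^ h].
Proof.
move=> hK h'K eh eh'; have xK : h^-1 * h' \in K by rewrite groupM ?groupV.
rewrite inE xK /=; apply/cent1P/commgP.
set x := h^-1 * h' in xK *; set b := e ^ h in eh *.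
have bx : b ^ x = e ^ h' by rewrite /b /x -conjgM mulKVg.
have : [~ x, b] \in K :&: B.
  rewrite inE; apply/andP; split.
    by rewrite commgEl groupMl ?groupV // memJ_norm // (subsetP nKB).
  by rewrite commgEr conjVg bx groupMl ?groupV.
by rewrite coprime_TIg // => /set1P ->.
Qed.

Lemma label_base e h h' : h \in K -> h' \in K -> e ^ h \in B -> e ^ h' \in B ->
  e ^ h = e ^ h'.
Proof.
move=> hK h'K eh eh'; have /setIP[_ /cent1P cx] := label_diff hK h'K eh eh'.
have : (e ^ h) ^ (h^-1 * h') = e ^ h by apply/conjg_fixP/commgP.
by rewrite -conjgM mulKVg.
Qed.

Definition transition E F := (label E)^-1 * label F.

Lemma meet_label e E : E \in P -> e \in E -> e ^ label E \in B.
Proof.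
by move=> /labelP[_ sEB] eE; apply: (subsetP sEB); rewrite memJ_conjg.
Qed.

Lemma transition_in e E F : e != 1 -> E \in P -> F \in P -> e \in E -> e \in F ->
  e ^ label E \in B^# /\ transition E F \in 'C_K[e ^ label E].
Proof.
move=> e1 EP FP eE eF; split; first by rewrite !inE conjg_eq1 e1 meet_label.
by have [[? _] [? _]] := (labelP EP, labelP FP); apply: label_diff; rewrite ?meet_label.
Qed.

Lemma transition_base e E F : E \in P -> F \in P -> e \in E -> e \in F -> e != 1 ->
  e ^ label E = e ^ label F.
Proof.
move=> EP FP eE eF e1; have [[? _] [? _]] := (labelP EP, labelP FP).
by apply: label_base; rewrite ?meet_label.
Qed.

Lemma simplex_vertex c E : c \in oc -> E \in c -> E \in P.
Proof. by rewrite inE => /and3P[_ /subsetP cP _]; exact: cP. Qed.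

(** The members of a simplex contain a common [e] distinct from 1, so the three
    transitions lie in the centralizer of one element of [B^#], where the
    cocycle condition is one of the permitted relations. *)
Lemma transition_triangle E F H : [set E; F; H]%SET \in oc ->
  word_equiv K B [:: transition E F; transition F H] [:: transition E H].
Proof.
move=> cK; have [e e1 eP] := Ap_meet cK.
have [EP FP HP] : [/\ E \in P, F \in P & H \in P].
  by split; apply: simplex_vertex cK _; rewrite !inE eqxx ?orbT.
have [eE eF eH] : [/\ e \in E, e \in F & e \in H].
  by split; apply: eP; rewrite !inE eqxx ?orbT.
have [bB xb] := transition_in e1 EP FP eE eF.
have [_ yb] := transition_in e1 FP HP eF eH.
have -> : transition E H = transition E F * transition F H.
  by rewrite /transition mulgA mulgK.
apply: word_equiv_mul bB xb _.
by rewrite (transition_base EP FP eE eF e1).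
Qed.

Definition word_of_path (s : seq {group gT}) :=
  if s is E :: s' then pairmap transition E s' else [::].

Lemma word_of_path_cat s E t :
  word_of_path (s ++ E :: t) = word_of_path (rcons s E) ++ pairmap transition E t.
Proof.
case: s => //= F s; rewrite -cat_rcons pairmap_cat last_rcons.
by [].
Qed.

(** Transitions behave as a cocycle, so the word of a path depends only on the
    homotopy class of the path. *)
Lemma word_of_path_homotopic s t : edge_homotopic oc s t ->
  word_equiv K B (word_of_path s) (word_of_path t).
Proof.
apply: rewrites_map => q r {}s {}t [E F H EFH|E] /=; rewrite !word_of_path_cat /=.
  apply: rew_cat (rew_refl _ _) _.
  exact: (rew_cat (transition_triangle EFH) (rew_refl _ _)).
apply: rew_cat (rew_refl _ _) _; rewrite {1}/transition mulVg.
exact: (rew_cat (word_equiv_one K B) (rew_refl _ _)).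
Qed.

(** ** The path of a word *)

Definition apex h := (B :^ h^-1)%G.
Definition spoke h b := (<[b]> :^ h^-1)%G.
Definition fixed_by x := odflt 1 [pick b in B^# | x \in 'C_K[b]].

Lemma fixed_byP x : letter K B x -> fixed_by x \in B^# /\ x \in 'C_K[fixed_by x].
Proof.
case/letterP => b bB xb; rewrite /fixed_by; case: pickP => [c /andP[]//|/(_ b)].
by rewrite bB xb.
Qed.

(** A letter [x] fixed by [b] gives the two edges from [B :^ h^-1] to
    [B :^ (h * x)^-1] through [<[b]> :^ h^-1], a subgroup of both.  A word thus
    gives a path, which is closed if the product of the word is 1. *)
Fixpoint path_of_word h w :=
  if w is x :: w' then
    [:: spoke h (fixed_by x), apex (h * x) & path_of_word (h * x) w']
  else [::].

Lemma path_of_word_cat h w w' : path_of_word h (w ++ w') =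
  path_of_word h w ++ path_of_word (h * \prod_(x <- w) x) w'.
Proof.
elim: w h => [|x w IHw] h /=; first by rewrite big_nil mulg1.
by rewrite IHw big_cons mulgA.
Qed.

Lemma last_path_of_word h w :
  last (apex h) (path_of_word h w) = apex (h * \prod_(x <- w) x).
Proof.
elim: w h => [|x w IHw] h /=; first by rewrite big_nil mulg1.
by rewrite IHw big_cons mulgA.
Qed.

Lemma apex_in h : h \in K -> apex h \in P.
Proof. by move=> hK; apply: conj_Ap. Qed.

Lemma spoke_in h b : h \in K -> b \in B^# -> spoke h b \in P.
Proof.
move=> hK /setD1P[b1 bB].
by apply: conj_Ap; rewrite ?cycle_subG ?cycle_eq1.
Qed.

Lemma spoke_sub h b : b \in B^# -> spoke h b \subset apex h.
Proof. by case/setD1P => _ bB; rewrite conjSg cycle_subG. Qed.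

Lemma spoke_shift h b x : x \in 'C_K[b] -> spoke (h * x) b = spoke h b.
Proof.
move=> /setIP[_ /cent1P xb]; apply/val_inj; rewrite /= invMg conjsgM.
congr (_ :^ _); apply/normP; rewrite groupV.
by apply: (subsetP (cent_sub _)); rewrite cent_cycle; apply/cent1P.
Qed.

Lemma word_cancel b x : b \in B^# -> x \in 'C_K[b] ->
  word_equiv K B [:: x; x^-1] [::] /\ word_equiv K B [:: x^-1; x] [::].
Proof.
move=> bB xb; have xVb : x^-1 \in 'C_K[b] by rewrite groupV.
split; apply: rew_trans (word_equiv_one K B).
  by rewrite -(mulgV x); apply: word_equiv_mul xb xVb.
by rewrite -(mulVg x); apply: word_equiv_mul xVb xb.
Qed.

(** The label chosen for [B :^ h^-1] may differ from [h], but only by an element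
    that centralizes [B]. *)
Definition apex_shift h := h^-1 * label (apex h).

Lemma apex_label_diff E b h : E \in P -> h \in K -> b ^ h^-1 \in E -> b \in B ->
  h^-1 * label E \in 'C_K[b].
Proof.
move=> EP hK bE bB; have [lK _] := labelP EP.
rewrite -[b in 'C_K[b]](conjgKV h b).
by apply: label_diff => //; [rewrite conjgKV | exact: meet_label].
Qed.

(** Up to the shift of labels at the two ends, the path of a word gives back that
    word.  At each inner apex the shifts cancel. *)
Lemma word_of_path_of_word h w : h \in K -> all (letter K B) w ->
  word_equiv K B (word_of_path (apex h :: path_of_word h w))
    ((apex_shift h)^-1 :: w ++ [:: apex_shift (h * \prod_(x <- w) x)]).
Proof.
have shiftP b g : b \in B^# -> g \in K -> apex_shift g \in 'C_K[b].
  move=> /setD1P[b1 bB] gK; apply: apex_label_diff => //; first exact: apex_in.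
  by rewrite memJ_conjg.
elim: w h => [|x w IHw] h hK /=.
  have /trivgPn[b bB b1] := B1; rewrite big_nil mulg1 => _.
  have bB1 : b \in B^# by rewrite !inE b1.
  exact: rew_sym (proj2 (word_cancel bB1 (shiftP _ _ bB1 hK))).
case/andP=> /fixed_byP[]; set b := fixed_by x => bB xb wL.
have xK : x \in K by case/setIP: xb.
have hxK : h * x \in K by rewrite groupM.
set E := spoke h b; have EP : E \in P by exact: spoke_in.
have bE : b ^ h^-1 \in E by rewrite memJ_conjg cycle_id.
have bB' : b \in B by case/setD1P: bB.
have dE : h^-1 * label E \in 'C_K[b] by exact: apex_label_diff.
rewrite big_cons mulgA.
have := IHw _ hxK wL; rewrite /= => IH.
apply: (rew_trans [:: (apex_shift h)^-1, x, apex_shift (h * x), (apex_shift (h * x))^-1 &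
   w ++ [:: apex_shift (h * x * \prod_(x <- w) x)]]); last first.
  have [cc _] := word_cancel bB (shiftP _ _ bB hxK).
  exact: (rew_ctx [:: _; _] _ cc).
have shiftx : (apex_shift h)^-1 * x \in 'C_K[b] by rewrite groupM ?groupV ?shiftP.
have xE : x^-1 * (h^-1 * label E) \in 'C_K[b] by rewrite groupM ?groupV.
apply: (rew_trans [:: (apex_shift h)^-1 * x * apex_shift (h * x),
    (apex_shift (h * x))^-1 & w ++ [:: apex_shift (h * x * \prod_(x <- w) x)]]); last first.
  apply: rew_sym; apply: (rew_trans [:: (apex_shift h)^-1 * x, apex_shift (h * x),
    (apex_shift (h * x))^-1 & w ++ [:: apex_shift (h * x * \prod_(x <- w) x)]]).
    apply: (rew_ctx [::] _ (word_equiv_mul bB _ xb)).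
    by rewrite groupV shiftP.
  exact: (rew_ctx [::] _ (word_equiv_mul bB shiftx (shiftP _ _ bB hxK))).
apply: (@rew_cat _ _ [:: _; _] [:: _] _ _ _ IH).
have -> : (apex_shift h)^-1 * x * apex_shift (h * x) =
    transition (apex h) E * transition E (apex (h * x)).
  by rewrite /apex_shift /transition !(invMg, invgK, mulgA) !(mulgK, mulgKV).
apply: (word_equiv_mul bB).
  have -> : transition (apex h) E = (apex_shift h)^-1 * (h^-1 * label E).
    by rewrite /apex_shift /transition !(invMg, invgK, mulgA) !(mulgK, mulgKV).
  by rewrite groupM ?groupV ?shiftP.
have -> : transition E (apex (h * x)) =
    (x^-1 * (h^-1 * label E))^-1 * apex_shift (h * x).
  by rewrite /apex_shift /transition !(invMg, invgK, mulgA) !(mulgK, mulgKV).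
by rewrite groupM ?groupV ?shiftP.
Qed.

Lemma path_path_of_word h w : h \in K -> all (letter K B) w ->
  path (adjacent oc) (apex h) (path_of_word h w).
Proof.
elim: w h => //= x w IHw h hK /andP[/fixed_byP[bB xb] wL].
have xK : x \in K by case/setIP: xb.
have hxK : h * x \in K by rewrite groupM.
rewrite IHw // andbT /adjacent.
have sP := spoke_in hK bB; have [aP aP'] := (apex_in hK, apex_in hxK).
have sub' : spoke h (fixed_by x) \subset apex (h * x).
  by rewrite -(spoke_shift h xb) spoke_sub.
apply/andP; split; last by have := Ap_chain sP sP aP' (subxx _) sub'; rewrite setUid.
by have := Ap_chain sP sP aP (subxx _) (spoke_sub h bB); rewrite setUid setUC.
Qed.

(** A word with product 1 gives a closed path, which is contractible; so the
    word of that path, a conjugate of the given word by [c], is equivalent to the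
    empty word. *)
Lemma edge_simply_connected_amalgam : edge_simply_connected oc -> amalgam K B.
Proof.
case=> _ _ loop w wL w1; have K1 := group1 K.
have /trivgPn[b bB b1] := B1; have bB1 : b \in B^# by rewrite !inE b1.
have := loop (apex 1) (path_of_word 1 w); rewrite Ap_vertex apex_in //.
rewrite path_path_of_word // last_path_of_word w1 mulg1 => /(_ isT isT erefl).
move/word_of_path_homotopic; rewrite [X in word_equiv _ _ _ X]/= => e1.
have := word_of_path_of_word K1 wL; rewrite w1 mulg1.
set c := apex_shift 1 => /rew_sym/rew_trans/(_ e1) e2.
have cb : c \in 'C_K[b].
  apply: apex_label_diff => //; first exact: apex_in.
  by rewrite memJ_conjg.
have [cc _] := word_cancel bB1 cb.
apply: (rew_trans ([:: c; c^-1] ++ w ++ [:: c; c^-1])).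
  apply: rew_sym; apply: (rew_cat (t := w ++ [:: c; c^-1]) (t' := w) cc).
  by have := rew_cat (rew_refl _ w) cc; rewrite cats0.
have -> : [:: c; c^-1] ++ w ++ [:: c; c^-1] = [:: c] ++ (c^-1 :: w ++ [:: c]) ++ [:: c^-1].
  by rewrite /= -catA.
exact: rew_trans (rew_ctx [:: c] [:: c^-1] e2) cc.
Qed.

(** ** The word of a path *)

Lemma edge_flag E F : E \in P -> F \in P -> E \subset F ->
  edge_homotopic oc [:: E; F; E] [:: E] /\ edge_homotopic oc [:: F; E; F] [:: F].
Proof.
move=> EP FP EF; split.
  apply: rew_trans (edge_repeat oc E); apply: edge_triangle.
  by have := Ap_chain EP EP FP (subxx _) EF; rewrite -!setUA [_ |: [set F]]setUC.
apply: rew_trans (edge_repeat oc F); apply: edge_triangle.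
by have := Ap_chain EP FP FP EF (subxx _); rewrite [[set F; E]]setUC.
Qed.

(** Both paths are homotopic to the one through [E1 :&: E2]. *)
Lemma edge_fan E1 E2 F F' : E1 \in P -> E2 \in P -> F \in P -> F' \in P ->
    F \subset E1 -> F \subset E2 -> F' \subset E1 -> F' \subset E2 ->
  edge_homotopic oc [:: E1; F; E2] [:: E1; F'; E2].
Proof.
move=> E1P E2P.
have meetP D : D \in P -> D \subset E1 -> D \subset E2 ->
    edge_homotopic oc [:: E1; D; E2] [:: E1; (E1 :&: E2)%G; E2].
  move=> DP D1 D2; have DI : D \subset (E1 :&: E2)%G by rewrite subsetI D1.
  have IP : (E1 :&: E2)%G \in P.
    apply: Ap_sub E1P (subsetIl _ _) _.
    by apply: contraTneq DP => /= I1; rewrite !inE -val_eqE /= -subG1 -I1 DI.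
  apply: (rew_trans [:: E1; D; (E1 :&: E2)%G; E2]).
    apply: rew_sym; apply: rew_cat (rew_refl _ [:: E1]) (edge_triangle _).
    by apply: Ap_chain; rewrite ?subsetIr.
  apply: (rew_cat (edge_triangle _) (rew_refl _ [:: E2])).
  have := Ap_chain DP IP E1P DI (subsetIl _ _).
  by rewrite setUC setUA.
move=> FP F'P F1 F2 F'1 F'2.
exact: rew_trans (meetP F FP F1 F2) (rew_sym (meetP F' F'P F'1 F'2)).
Qed.

Lemma spoke_sub_end h x b : b \in B^# -> x \in 'C_K[b] -> spoke h b \subset apex (h * x).
Proof. by move=> bB xb; rewrite -(spoke_shift h xb) spoke_sub. Qed.

(** For a product of two letters in ['C_K[b]] all spokes can be replaced by the
    same subgroup [<[b]> :^ h^-1], and the path backtracks there. *)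
Lemma path_of_word_step h s t : h \in K -> word_step K B s t ->
  edge_homotopic oc (apex h :: path_of_word h s) (apex h :: path_of_word h t).
Proof.
have fan g x b : g \in K -> b \in B^# -> x \in 'C_K[b] ->
    edge_homotopic oc [:: apex g; spoke g (fixed_by x); apex (g * x)]
      [:: apex g; spoke g b; apex (g * x)].
  move=> gK bB xb; have [cB xc] : fixed_by x \in B^# /\ x \in 'C_K[fixed_by x].
    by apply: fixed_byP; apply/letterP; exists b.
  have xK : x \in K by case/setIP: xb.
  by apply: edge_fan; rewrite ?apex_in ?spoke_in ?spoke_sub ?spoke_sub_end ?groupM.
move=> hK; case=> [b x y bB xb yb|] /=.
  have [xK _] := setIP xb; have hxK : h * x \in K by rewrite groupM.
  apply: (rew_trans [:: apex h; spoke h b; apex (h * x); spoke (h * x) b;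
                        apex (h * x * y)]).
    apply: (rew_trans [:: apex h; spoke h b; apex (h * x);
                          spoke (h * x) (fixed_by y); apex (h * x * y)]).
      exact: (rew_cat (fan h x b hK bB xb) (rew_refl _ [:: _; _])).
    exact: (rew_cat (rew_refl _ [:: _; _]) (fan (h * x) y b hxK bB yb)).
  rewrite spoke_shift //.
  apply: (rew_trans _ _ (rew_sym (fan h (x * y) b hK bB _))); last by rewrite groupM.
  have [] := edge_flag (spoke_in hK bB) (apex_in hxK) (spoke_sub_end h bB xb).
  by rewrite mulgA => e _; exact: (rew_ctx [:: _] [:: _] e).
rewrite mulg1; have /trivgPn[b bB b1] := B1.
have bB1 : b \in B^# by rewrite !inE b1.
have := fan h 1 b hK bB1 (group1 _); rewrite mulg1 => /rew_trans; apply.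
by apply: (proj2 (edge_flag _ _ _)); rewrite ?spoke_in ?apex_in // spoke_sub.
Qed.

Lemma path_of_word_equiv w w' : word_equiv K B w w' -> all (letter K B) w ->
  forall h, h \in K ->
    edge_homotopic oc (apex h :: path_of_word h w) (apex h :: path_of_word h w').
Proof.
have lettersE := @word_equiv_letters gT K B; rewrite cardG_gt1 in lettersE.
elim=> {w w'} [q r s t st|s _ h _|s t st IH tL h hK|s t u st IH tu IH' sL h hK].
- elim: q => [|x q IHq] /= wL h hK.
    rewrite !path_of_word_cat -!cat_cons.
    have -> : \prod_(x <- s) x = \prod_(x <- t) x.
      exact: word_equiv_prod (rew1 st).
    exact: rew_cat (path_of_word_step hK st) (rew_refl _ _).
  case/andP: wL => /letter_in xK wL.
  by do 2!apply: rew_cons; apply: IHq => //; rewrite groupM.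
- exact: rew_refl.
- by apply/rew_sym/IH; rewrite ?(lettersE _ _ B1 st).
- by apply: rew_trans (IH sL h hK) (IH' _ h hK); rewrite -(lettersE _ _ B1 st).
Qed.

Lemma sub_apex_label E : E \in P -> E \subset apex (label E).
Proof. by case/labelP => _; rewrite sub_conjg. Qed.

Lemma adjacent_Ap E F : adjacent oc E F ->
  [/\ E \in P, F \in P & E \subset F \/ F \subset E].
Proof.
move=> EF; split; try by apply: simplex_vertex EF _; rewrite !inE eqxx ?orbT.
move: EF; rewrite /adjacent inE => /and3P[_ _ /forall_inP/(_ E)].
rewrite !inE eqxx => /(_ isT)/forall_inP/(_ F); rewrite !inE eqxx orbT.
by move=> /(_ isT)/orP.
Qed.

Lemma adjacent_letter E F : adjacent oc E F -> letter K B (transition E F).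
Proof.
move=> EF; have [EP FP _] := adjacent_Ap EF.
have [e e1 eP] := Ap_meet EF.
have [eE eF] : e \in E /\ e \in F by split; apply: eP; rewrite !inE eqxx ?orbT.
by have [bB xb] := transition_in e1 EP FP eE eF; apply/letterP; exists (e ^ label E).
Qed.

(** Every path is homotopic to the path of its word, completed at both ends:
    each edge from [E] to [F] is pushed up to the apexes above [E] and [F], using
    that the smaller one of [E] and [F] lies below both apexes. *)
Lemma path_decomposition E s : E \in P -> path (adjacent oc) E s ->
  edge_homotopic oc (E :: s)
    (E :: apex (label E) :: path_of_word (label E) (word_of_path (E :: s)) ++ [:: last E s]).
Proof.
elim: s E => [|F s IHs] E EP /=.
  move=> _; have [lK _] := labelP EP.
  by apply/rew_sym/(proj1 (edge_flag _ _ _)); rewrite ?apex_in ?sub_apex_label.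
case/andP=> EF Fs; have [_ FP sEF] := adjacent_Ap EF.
have [[lE _] [lF _]] := (labelP EP, labelP FP).
have xF : label E * transition E F = label F by rewrite mulKVg.
have [bB xb] := fixed_byP (adjacent_letter EF).
set x := transition E F in xF bB xb *; set b := fixed_by x in bB xb *.
rewrite xF; apply: (rew_trans _ (rew_cons E (IHs F FP Fs))).
apply: (@rew_cat _ _ [:: E; F; apex (label F)]
   [:: E; apex (label E); spoke (label E) b; apex (label F)] _ _ _ (rew_refl _ _)).
have [D [DP DE DF ED]] : exists D, [/\ D \in P, D \subset E, D \subset F
    & [set E; D; F]%SET \in oc].
  case: sEF => [EF'|FE]; [exists E | exists F]; split=> //.
    exact: Ap_chain.
  by rewrite -setUA setUid.
have [aE aF] := (apex_in lE, apex_in lF).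
have [sE sF] := (sub_apex_label EP, sub_apex_label FP).
have [DaE DaF] := (subset_trans DE sE, subset_trans DF sF).
apply: (rew_trans [:: E; D; F; apex (label F)]).
  exact: (rew_cat (rew_sym (edge_triangle ED)) (rew_refl _ [:: _])).
apply: (rew_trans [:: E; D; apex (label F)]).
  exact: (rew_cat (rew_refl _ [:: E]) (edge_triangle (Ap_chain DP FP aF DF sF))).
apply: (rew_trans [:: E; apex (label E); D; apex (label F)]).
  apply: (rew_cat (rew_sym (edge_triangle _)) (rew_refl _ [:: apex (label F)])).
  have := Ap_chain DP EP aE DE sE.
  by rewrite -setUA setUC.
apply: (rew_cat (rew_refl _ [:: E]) (edge_fan _ _ _ _ _ _ _ _)) => //.
- exact: spoke_in.
- exact: spoke_sub.
- by rewrite -xF spoke_sub_end.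
Qed.

Lemma amalgam_edge_simply_connected :
    (forall x, x \in K -> exists2 w, all (letter K B) w & \prod_(y <- w) y = x) ->
  amalgam K B -> edge_simply_connected oc.
Proof.
move=> gen amal; split.
- by exists (apex 1); rewrite Ap_vertex apex_in.
- move=> E F; rewrite !Ap_vertex => EP FP.
  have [[lE _] [lF _]] := (labelP EP, labelP FP).
  have [w wL w1] := gen (transition E F) (groupM (groupVr lE) lF).
  exists (apex (label E) :: path_of_word (label E) w ++ [:: F]); last first.
    by rewrite /= last_cat.
  rewrite /= cat_path path_path_of_word // last_path_of_word w1 mulKVg /= andbT.
  rewrite /adjacent; have [aE aF] := (apex_in lE, apex_in lF).
  have := Ap_chain EP EP aE (subxx _) (sub_apex_label EP); rewrite setUid => ->.
  by have := Ap_chain FP FP aF (subxx _) (sub_apex_label FP); rewrite setUid setUC => ->.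
move=> E s; rewrite Ap_vertex => EP Es lastE.
apply: rew_trans (path_decomposition EP Es) _.
have [lE _] := labelP EP.
have wL F t : path (adjacent oc) F t -> all (letter K B) (pairmap transition F t).
  by elim: t F => //= H t IHt F /andP[/adjacent_letter-> /IHt].
have w1 F t : \prod_(x <- pairmap transition F t) x = (label F)^-1 * label (last F t).
  elim: t F => [|H t IHt] F /=; first by rewrite big_nil mulVg.
  by rewrite big_cons IHt /transition mulgA mulgK.
have /(path_of_word_equiv)/(_ (wL E s Es) _ lE) e1 :
    word_equiv K B (word_of_path (E :: s)) [::].
  by apply: amal; [exact: wL | rewrite /= w1 lastE mulVg].
apply: (rew_trans [:: E; apex (label E); E]).
  rewrite lastE; exact: (rew_cat (rew_refl _ [:: E]) (rew_cat e1 (rew_refl _ [:: E]))).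
by apply: (proj1 (edge_flag _ _ _)); rewrite ?apex_in ?sub_apex_label.
Qed.

End PathsAndWords.

(** * Generation by fixed points of a coprime action *)

Section FixedPointGeneration.
Variables (gT : finGroupType) (p : nat).
Import GroupScope FiniteModule.
Local Open Scope group_scope.
Implicit Types (K V H : {group gT}).

Definition fixed_points K V : {set gT} := \bigcup_(v in V^#) 'C_K[v].

Lemma fixed_points_sub K V : fixed_points K V \subset K.
Proof. by apply/bigcupsP => v _; apply: subsetIl. Qed.

Lemma fixed_pointsS K H V : H \subset K -> fixed_points H V \subset fixed_points K V.
Proof.
move=> HK; apply/bigcupsP => v vV; apply: subset_trans (bigcup_sup v vV).
exact: setSI.
Qed.

(** The sum over [P], a subgroup of order [p] of [V], of the transforms of [m] is
    fixed by [P].  There are [p.+1] such [P]; each nontrivial [v] lies in exactly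
    one of them and 1 lies in all.  So the total of these sums is [m *+ p] plus
    the sum over [V], which is also a fixed point, and [m] is a multiple of
    [m *+ p]. *)
Lemma abelian_fixed_points K V : abelian K -> p^'.-group K -> V \subset 'N(K) ->
  V \in 'E_p^2(V) -> K \subset <<fixed_points K V>>.
Proof.
move=> abK p'K nKV VE; have p_pr := pnElem_prime VE.
have [_ abelV oV] := pnElemPcard VE.
apply/subsetP => x Kx; set H := <<_>>.
have coxp : coprime #[x] p.
  by rewrite coprime_sym (pnat_coprime (pnat_id p_pr) (mem_p_elt p'K Kx)).
suff xpH : x ^+ p \in H.
  have /eqP xp : generator <[x]> (x ^+ p) by rewrite generator_coprime.
  by rewrite -cycle_subG xp cycle_subG.
pose m := fmod abK x.
pose T (P : {group gT}) := (\sum_(v in P) m ^@ v)%R.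
have Tfix (P : {group gT}) v : P \subset V -> v \in P -> v != 1 -> val (T P) \in H.
  move=> PV vP v1; have vV := subsetP PV v vP.
  apply/mem_gen/bigcupP; exists v; first by rewrite !inE v1.
  rewrite inE fmodP /=; apply/cent1P/commgP/conjg_fixP.
  rewrite -fmvalJ ?(subsetP nKV) //; congr val; rewrite /T actr_sum.
  rewrite [RHS](reindex_inj (mulIg v)) /=.
  apply: eq_big => [w|w wP]; first by rewrite groupMr.
  by rewrite actrM ?(subsetP nKV) // (subsetP PV).
have sumT : (\sum_(P in 'E_p^1(V)) T P = m *+ p + T V)%R.
  rewrite /T (exchange_big_dep (mem V)) /=; last first.
    by move=> P v /pnElemP[PV _ _] vP; apply: (subsetP PV).
  rewrite (bigD1 1) ?group1 //= [in RHS](bigD1 1) ?group1 //= actr1 addrA.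
  rewrite -mulrSr -(card_p1Elem_p2Elem VE) -sumr_const; congr (_ + _)%R.
    by apply: eq_bigl => P; rewrite group1 andbT.
  apply: eq_bigr => v /andP[vV v1]; have ov := abelem_order_p abelV vV v1.
  rewrite (big_pred1 <[v]>%G) // => P; apply/andP/eqP => [[PE vP]|->].
    apply/val_inj/eqP; rewrite /= eq_sym eqEcard cycle_subG vP -orderE ov.
    by rewrite (card_p1Elem PE) leqnn.
  by rewrite cycle_id p1ElemE // !inE cycle_subG vV -orderE ov eqxx.
have -> : x ^+ p = val (\sum_(P in 'E_p^1(V)) T P - T V)%R.
  by rewrite sumT addrK fmvalZ fmodK.
have [v vV v1] : exists2 v, v \in V & v != 1.
  by apply/trivgPn; rewrite -cardG_gt1 oV (ltn_exp2l 0) ?prime_gt1.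
rewrite fmvalA fmvalN groupM ?groupV ?(Tfix V v) //.
apply: (big_ind (fun u => val u \in H)) => [|a b aH bH|P PE].
- by rewrite fmval0 group1.
- by rewrite fmvalA groupM.
have [PV _ oP] := pnElemPcard PE.
have [w wP w1] : exists2 w, w \in P & w != 1.
  by apply/trivgPn; rewrite -cardG_gt1 oP (ltn_exp2l 0) ?prime_gt1.
exact: Tfix wP w1.
Qed.

End FixedPointGeneration.

Section NonabelianFixedPoints.
Variables (gT : finGroupType) (p : nat).
Import GroupScope.
Local Open Scope group_scope.
Implicit Types (K V H : {group gT}).

(** Fixed points lift from [K / K^`(1)] by coprimality, and [K^`(1)] consists of
    nongenerators of the [q]-group [K]. *)
Lemma nilpotent_fixed_points (q : nat) K V : q.-group K -> p^'.-group K -> V \subset 'N(K) ->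
  V \in 'E_p^2(V) -> K \subset <<fixed_points K V>>.
Proof.
move=> qK p'K nKV VE; have [_ abelV oV] := pnElemPcard VE.
have solK := pgroup_sol qK.
have nK' : V \subset 'N(K^`(1)) := char_norm_trans (der_char 1 K) nKV.
have coKV : coprime #|K| #|V|.
  by rewrite coprime_sym (pnat_coprime (abelem_pgroup abelV)).
have TI : K^`(1) :&: V = 1.
  by apply: coprime_TIg; apply: coprimeSg coKV; exact: der_sub.
have isoV := quotient_isog nK' TI.
have VE' : (V / K^`(1))%G \in 'E_p^2((V / K^`(1))%G).
  rewrite pnElemE ?(pnElem_prime VE) // !inE subxx quotient_abelem //=.
  by rewrite -(card_isog isoV) oV.
have nKK' := der_norm 1 K.
have := @abelian_fixed_points _ p (K / K^`(1))%G (V / K^`(1))%G (der_abelian 0 K)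
  (quotient_pgroup _ p'K) (quotient_norms _ nKV) VE'.
set W := <<_>> => sKW.
have sFW : W \subset <<fixed_points K V>> / K^`(1).
  rewrite gen_subG; apply/bigcupsP => vb; rewrite !inE => /andP[vb1].
  case/morphimP => v Nv Vv /= def_vb.
  have v1 : v != 1 by apply: contraNneq vb1 => v1; rewrite def_vb v1 morph1.
  rewrite def_vb -cent_cycle -quotient_cycle // -coprime_quotient_cent ?der_sub //.
  - rewrite cent_cycle quotientS // sub_gen // (bigcup_sup v) //.
    by rewrite !inE v1.
  - by rewrite cycle_subG.
  - by apply: coprimegS coKV; rewrite cycle_subG.
have := subset_trans sKW sFW.
rewrite quotientSK // => sK.
suff -> : <<fixed_points K V>> = K by [].
apply/Phi_nongen/eqP; rewrite eqEsubset join_subG Phi_sub fixed_points_sub /=.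
apply: subset_trans sK _; rewrite mul_subG ?joing_subr //.
  by apply: subset_trans (joing_subl _ _); rewrite (Phi_joing qK) joing_subl.
by rewrite gen_subG joing_subr.
Qed.

(** For each prime [q], [V] normalizes a Sylow [q]-subgroup of [K], so the
    subgroup generated by fixed points contains a Sylow subgroup for each
    prime. *)
Lemma coprime_fixed_points K V : p^'.-group K -> V \subset 'N(K) ->
  V \in 'E_p^2(V) -> K \subset <<fixed_points K V>>.
Proof.
move=> p'K nKV VE; have [_ abelV oV] := pnElemPcard VE.
have coKV : coprime #|K| #|V|.
  by rewrite coprime_sym (pnat_coprime (abelem_pgroup abelV)).
have solV : solvable V := abelian_sol (abelem_abelian abelV).
set H := <<fixed_points K V>>%G.
have HK : H \subset K by rewrite gen_subG fixed_points_sub.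
rewrite -indexg_eq1 /=; apply/eqP; apply: contraTeq isT => ne1.
pose q := pdiv #|K : H|.
have q_pr : prime q by rewrite pdiv_prime // ltn_neqAle eq_sym ne1 indexg_gt0.
have [Q sylQ nQV] := sol_coprime_Sylow_exists q solV nKV coKV.
have [QK qQ _] := and3P sylQ.
have QH : Q \subset H.
  apply: subset_trans (nilpotent_fixed_points qQ (pgroupS QK p'K) nQV VE) _.
  by rewrite genS // fixed_pointsS.
have : q^'.-nat #|K : Q| by case/and3P: sylQ.
rewrite -(Lagrange_index HK QH) pnatM => /andP[+ _].
by rewrite p'natE // pdiv_dvd.
Qed.

End NonabelianFixedPoints.

(** * Reductions for the amalgam property *)

Section Amalgams.
Variables (gT : finGroupType) (p : nat).
Import GroupScope.
Local Open Scope group_scope.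
Implicit Types (K N A B : {group gT}) (w : seq gT) (P : pred gT).

Lemma generated_word K B x : x \in <<fixed_points K B>> ->
  exists2 w, all (letter K B) w & \prod_(y <- w) y = x.
Proof.
case/gen_prodgP => n [c cP ->]; exists [seq c i | i <- index_enum 'I_n].
  apply/allP => _ /mapP[i _ ->]; apply/letterP.
  by have /bigcupP[b bB cb] := cP i; exists b.
by rewrite big_map.
Qed.

Lemma word_equiv_mono K N A B w w' : K \subset N -> B \subset A ->
  word_equiv K B w w' -> word_equiv N A w w'.
Proof.
move=> KN BA; apply: (rewrites_map (f := id)) => s t u v [b x y bB xb yb|].
  have sub z : z \in 'C_K[b] -> z \in 'C_N[b] by apply/subsetP/setSI.
  apply/rew_step/(word_mul (b := b)); rewrite ?sub //.
  by apply: subsetP bB; rewrite setSD.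
exact/rew_step/word_one.
Qed.

Lemma word_equiv_single K B b w : b \in B^# -> all (mem 'C_K[b]) w ->
  word_equiv K B w [:: \prod_(x <- w) x].
Proof.
move=> bB; elim: w => [|x w IHw] /=.
  by rewrite big_nil => _; exact/rew_sym/word_equiv_one.
case/andP=> xb wb; rewrite big_cons.
apply: (rew_trans [:: x; \prod_(x <- w) x]).
  exact: rew_cons (IHw wb).
apply: (word_equiv_mul bB) => //.
by rewrite big_seq; apply: group_prod => y /(allP wb).
Qed.

Lemma word_equiv_refine K B P w :
  (forall x, x \in w -> exists2 u, all P u & word_equiv K B [:: x] u) ->
  exists2 u, all P u & word_equiv K B w u.
Proof.
elim: w => [|x w IHw] wP; first by exists [::] => //; exact: rew_refl.
have [u uP xu] := wP x (mem_head _ _).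
have [|v vP wv] := IHw; first by move=> y yw; apply: wP; rewrite inE yw orbT.
exists (u ++ v); first by rewrite all_cat uP.
exact: (rew_cat (s := [:: x]) xu wv).
Qed.

Lemma letterS K N A B x : K \subset N -> B \subset A -> letter K B x -> letter N A x.
Proof.
move=> KN BA /letterP[b bB xb]; apply/letterP; exists b.
  by apply: subsetP bB; rewrite setSD.
by apply: subsetP xb; apply: setSI.
Qed.

(** [A] is abelian, so it acts on ['C_K[a]]; the action of the noncyclic
    subgroup [E] is enough to generate. *)
Lemma centralizer_word K A E a x : p.-abelem A -> p^'.-group K -> A \subset 'N(K) ->
    E \in 'E_p^2(A) -> a \in A^# -> x \in 'C_K[a] ->
  exists2 u, all (letter 'C_K[a]%G E) u & \prod_(y <- u) y = x.
Proof.
move=> abelA p'K nKA EA2 aA xa; have [EA abelE oE] := pnElemPcard EA2.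
have cAA := abelem_abelian abelA; have [_ aA'] := setD1P aA.
have nCE : E \subset 'N('C_K[a]).
  have nEa : E \subset 'N(<[a]>).
    by rewrite cents_norm // (subset_trans EA) // (subset_trans cAA) // centS // cycle_subG.
  by rewrite -cent_cycle normsI ?norms_cent // (subset_trans EA).
have EE : E \in 'E_p^2(E) by rewrite pnElemE ?(pnElem_prime EA2) // !inE subxx abelE oE /=.
have CE := coprime_fixed_points (pgroupS (subsetIl K 'C[a]) p'K) nCE EE.
exact: generated_word (subsetP CE x xa).
Qed.

Lemma centralizer_word_equiv K A a (H : {group gT}) E u : H \subset 'C_K[a] -> a \in A^# ->
  all (letter H E) u -> word_equiv K A [:: \prod_(y <- u) y] u.
Proof.
move=> Ha aA uP; apply/rew_sym/(word_equiv_single aA).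
by apply: sub_all uP => y /letter_in; exact: (subsetP Ha).
Qed.

(** No relations are added when [B] grows to [A], only generators, and each new
    generator is a product of old ones inside some ['C_K[a]]. *)
Lemma amalgam_mono K A B E : p.-abelem A -> p^'.-group K -> A \subset 'N(K) ->
  B \subset A -> E \in 'E_p^2(B) -> amalgam K B -> amalgam K A.
Proof.
move=> abelA p'K nKA BA EB2 amB w wA w1.
have EA2 := subsetP (pnElemS p 2 BA) _ EB2; have [EB _ _] := pnElemP EB2.
have [u uB wu] : exists2 u, all (letter K B) u & word_equiv K A w u.
  apply: word_equiv_refine => x /(allP wA)/letterP[a aA xa].
  have [u uE <-] := centralizer_word abelA p'K nKA EA2 aA xa.
  exists u; last exact: (centralizer_word_equiv (subxx _) aA uE).
  by apply: sub_all uE => y; apply: letterS => //; exact: subsetIl.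
apply: (rew_trans _ wu (word_equiv_mono (subxx K) BA _)).
by apply: amB => //; rewrite -(word_equiv_prod wu).
Qed.

Lemma amalgam_fixed K B b : b \in B^# -> K \subset 'C[b] -> amalgam K B.
Proof.
move=> bB Kb w wB w1; apply: rew_trans _ (word_equiv_one K B).
rewrite -w1; apply: (word_equiv_single bB).
by apply/allP => x /(allP wB)/letter_in xK; rewrite /= inE xK (subsetP Kb).
Qed.

(** Fixed points of subgroups of rank 2: still enough of them to generate when
    [B] has rank 3, and any two of them, from commuting factors, are letters for
    a common [b]. *)
Definition rank2_letter K B x :=
  (x \in K) && [exists E : {group gT}, (E \in 'E_p^2(B)) && (x \in 'C(E))].

Lemma rank2_letterP K B x : reflect
  (x \in K /\ exists2 E : {group gT}, E \in 'E_p^2(B) & x \in 'C(E)) (rank2_letter K B x).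
Proof.
apply: (iffP andP) => -[xK] => [/existsP[E /andP[]]|[E EB xE]]; first by split=> //; exists E.
by split=> //; apply/existsP; exists E; rewrite EB.
Qed.

Lemma rank2_letter_letter K B x : rank2_letter K B x -> letter K B x.
Proof.
case/rank2_letterP => xK [E EB2 xE]; have [EB _ oE] := pnElemPcard EB2.
have [e eE e1] : exists2 e, e \in E & e != 1.
  by apply/trivgPn; rewrite -cardG_gt1 oE (ltn_exp2l 0) ?prime_gt1 // (pnElem_prime EB2).
apply/letterP; exists e; first by rewrite !inE e1 (subsetP EB).
by rewrite inE xK /=; apply/cent1P; apply: (centP xE).
Qed.

Lemma rank2_meet B E F : p.-abelem B -> logn p #|B| <= 3 ->
    E \in 'E_p^2(B) -> F \in 'E_p^2(B) ->
  exists2 b, b \in B^# & (b \in E) && (b \in F).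
Proof.
move=> abelB rB EB2 FB2; have p_pr := pnElem_prime EB2.
have [[EB _ oE] [FB _ oF]] := (pnElemPcard EB2, pnElemPcard FB2).
have /trivgPn[b /setIP[bE bF] b1] : E :&: F != 1.
  apply: contraTneq rB => EF1; rewrite -ltnNge.
  have := mul_cardG E F; rewrite EF1 cards1 muln1 oE oF -expnD => oEF.
  have : (p ^ 4 <= #|B|)%N by rewrite oEF subset_leq_card // mul_subG.
  by rewrite {1}(card_pgroup (abelem_pgroup abelB)) leq_exp2l ?prime_gt1.
by exists b; rewrite ?bE // !inE b1 (subsetP EB).
Qed.

(** ['C_K[b]] is generated by fixed points of a complement [D] of [<[b]>] in [B]; an
    element of it fixed by [d] in [D^#] is fixed by [<[b]> <*> <[d]>]. *)
Lemma rank2_word K B b x : p.-abelem B -> logn p #|B| = 3 -> p^'.-group K ->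
    B \subset 'N(K) -> b \in B^# -> x \in 'C_K[b] ->
  exists2 u, all (rank2_letter K B) u & \prod_(y <- u) y = x /\ all (mem 'C_K[b]) u.
Proof.
move=> abelB rB p'K nKB bB xb; have [b1 bB'] := setD1P bB.
have p_pr : prime p by move: rB; rewrite lognE; case: prime.
have sbB : <[b]> \subset B by rewrite cycle_subG.
have /splitsP[D /complP[bD bDB]] := abelem_splits abelB sbB.
have DB : D \subset B by rewrite -bDB mulG_subr.
have oB : #|B| = (p ^ 3)%N by rewrite (card_pgroup (abelem_pgroup abelB)) rB.
have ob : #|<[b]>| = p by rewrite -orderE (abelem_order_p abelB).
have D2 : D \in 'E_p^2(B).
  rewrite pnElemE // !inE DB (abelemS DB) //=.
  by rewrite -(eqn_pmul2l (prime_gt0 p_pr)) -{1}ob -TI_cardMg // bDB oB.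
have [u uD <-] := centralizer_word abelB p'K nKB D2 bB xb.
exists u; last first.
  by split=> //; apply: sub_all uD => y /letter_in.
apply: sub_all uD => y /letterP[d /setD1P[d1 dD]] /setIP[/setIP[yK yb] yd].
apply/rank2_letterP; split=> //; have dB := subsetP DB d dD.
have cbd : <[d]> \subset 'C(<[b]>).
  by rewrite (subset_trans _ (subset_trans (abelem_abelian abelB) (centS sbB))) ?cycle_subG.
have tibd : <[b]> :&: <[d]> = 1.
  by apply/trivgP; rewrite -bD setIS // cycle_subG.
exists (<[b]> <*> <[d]>)%G; last first.
  by rewrite /= centY !cent_cycle inE yb yd.
have sub : <[b]> <*> <[d]> \subset B by rewrite join_subG sbB cycle_subG.
rewrite pnElemE // !inE sub (abelemS sub) //= cent_joinEr // TI_cardMg // ob.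
by rewrite -orderE (abelem_order_p abelB).
Qed.

Lemma dprod_cent1 (N1 N2 N : {group gT}) b z : N1 \x N2 = N ->
    b \in 'N(N1) -> b \in 'N(N2) -> z \in 'C_N[b] ->
  exists2 z1, z1 \in 'C_N1[b] & exists2 z2, z2 \in 'C_N2[b] & z = z1 * z2.
Proof.
case/dprodP => _ <- cN12 TI nb1 nb2 /setIP[/mulsgP[z1 z2 z1N z2N ->] /cent1P zb].
have eqz : (z1 ^ b) * (z2 ^ b) = z1 * z2.
  by rewrite -conjMg; apply/conjg_fixP/commgP; exact: zb.
have z1b : z1 ^ b = z1.
  apply/eqP; rewrite eq_mulVg1 -in_set1 -[[set 1]]TI inE.
  rewrite groupMl ?groupV ?memJ_norm // z1N /=.
  have -> : (z1 ^ b)^-1 * z1 = (z2 ^ b) * z2^-1.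
    by apply: (mulgI (z1 ^ b)); rewrite mulKVg mulgA eqz mulgK.
  by rewrite groupM ?groupV ?memJ_norm.
have z2b : z2 ^ b = z2 by apply: (mulgI z1); rewrite -{1}z1b eqz.
exists z1; first by rewrite inE z1N; apply/cent1P/commgP/conjg_fixP.
by exists z2 => //; rewrite inE z2N; apply/cent1P/commgP/conjg_fixP.
Qed.

(** A word is rewritten with rank 2 letters of the factors, then sorted so that the
    letters of [N1] come first.  As the product is direct, both halves have
    product 1. *)
Lemma amalgam_dprod (N1 N2 N B : {group gT}) : N1 \x N2 = N -> p^'.-group N ->
    B \subset 'N(N1) -> B \subset 'N(N2) -> p.-abelem B -> logn p #|B| = 3 ->
  amalgam N1 B -> amalgam N2 B -> amalgam N B.
Proof.
move=> defN p'N nN1 nN2 abelB rB am1 am2 w wN w1.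
have [_ defN' cN12 TI] := dprodP defN.
have N1N : N1 \subset N by rewrite -defN' mulG_subl.
have N2N : N2 \subset N by rewrite -defN' mulG_subr.
pose Q := [pred x | rank2_letter N1 B x || rank2_letter N2 B x].
have [u uQ wu] : exists2 u, all Q u & word_equiv N B w u.
  apply: word_equiv_refine => z /(allP wN)/letterP[b bB zb].
  have bB' := subsetP (subsetDl _ _) b bB.
  have [z1 z1b [z2 z2b ->]] :=
    dprod_cent1 defN (subsetP nN1 b bB') (subsetP nN2 b bB') zb.
  have single (M : {group gT}) x : M \subset N -> B \subset 'N(M) -> x \in 'C_M[b] ->
      exists2 u, all (rank2_letter M B) u & word_equiv N B [:: x] u.
    move=> MN nM xb.
    have [u uP [<- ub]] := rank2_word abelB rB (pgroupS MN p'N) nM bB xb.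
    exists u => //; apply/rew_sym/(word_equiv_single bB).
    by apply: sub_all ub => y; apply: subsetP; rewrite setSI.
  have [u1 u1P zu1] := single N1 z1 N1N nN1 z1b.
  have [u2 u2P zu2] := single N2 z2 N2N nN2 z2b.
  exists (u1 ++ u2).
    rewrite all_cat; apply/andP; split; [apply: sub_all u1P|apply: sub_all u2P];
      by move=> y /= ->; rewrite ?orbT.
  apply: (rew_trans [:: z1; z2]); last exact: (rew_cat zu1 zu2).
  apply/rew_sym/(word_equiv_mul bB).
    by apply: subsetP z1b; rewrite setSI.
  by apply: subsetP z2b; rewrite setSI.
have swap x y : rank2_letter N1 B x -> rank2_letter N2 B y ->
    word_equiv N B [:: y; x] [:: x; y].
  move=> /rank2_letterP[xN [E EB xE]] /rank2_letterP[yN [F FB yF]].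
  have [b bB /andP[bE bF]] := rank2_meet abelB (eq_leq rB) EB FB.
  have xb : x \in 'C_N[b].
    by rewrite inE (subsetP N1N) //; apply/cent1P; apply: (centP xE).
  have yb : y \in 'C_N[b].
    by rewrite inE (subsetP N2N) //; apply/cent1P; apply: (centP yF).
  apply: (rew_trans [:: y * x]); first exact: (word_equiv_mul bB).
  have -> : y * x = x * y by apply: (centsP cN12).
  exact/rew_sym/(word_equiv_mul bB).
have push y u1 : rank2_letter N2 B y -> all (rank2_letter N1 B) u1 ->
    word_equiv N B (y :: u1) (u1 ++ [:: y]).
  move=> yP; elim: u1 => [|x u1 IH] /=; first by move=> _; exact: rew_refl.
  case/andP=> xP /IH e; apply: (rew_trans (x :: y :: u1)); last exact: rew_cons.
  exact: (rew_cat (swap x y xP yP) (rew_refl _ u1)).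
have [u1 [u2 [u1P u2P uu]]] : exists u1 u2, [/\ all (rank2_letter N1 B) u1,
    all (rank2_letter N2 B) u2 & word_equiv N B u (u1 ++ u2)].
  elim: u uQ {wu} => [|x u IH] /=; first by exists [::], [::]; split=> //; exact: rew_refl.
  case/andP=> xQ /IH[u1 [u2 [u1P u2P uu]]]; case/orP: xQ => xP.
    by exists (x :: u1), u2; split=> //=; [rewrite xP | exact: rew_cons].
  exists u1, (x :: u2); split=> //=; first by rewrite xP.
  apply: (rew_trans (x :: u1 ++ u2)); first exact: rew_cons.
  rewrite -(cat1s x u2) catA.
  exact: (rew_cat (push x u1 xP u1P) (rew_refl _ u2)).
have inM (M : {group gT}) v : all (rank2_letter M B) v -> \prod_(x <- v) x \in M.
  by move=> vP; rewrite big_seq; apply: group_prod => x /(allP vP)/rank2_letterP[].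
have [p1 p2] := (inM _ _ u1P, inM _ _ u2P).
have pw : \prod_(x <- u1) x * \prod_(x <- u2) x = 1.
  by rewrite -big_cat /= -(word_equiv_prod uu) -(word_equiv_prod wu).
have e1 : \prod_(x <- u1) x = 1.
  apply/set1P; rewrite -[[set 1]]TI inE p1.
  by rewrite (canRL (mulgK _) pw) mul1g groupV.
have e2 : \prod_(x <- u2) x = 1 by move: pw; rewrite e1 mul1g.
apply: (rew_trans _ wu); apply: (rew_trans _ uu).
have lett (M : {group gT}) v : all (rank2_letter M B) v -> all (letter M B) v.
  exact/sub_all/rank2_letter_letter.
apply: (@rew_cat _ _ _ [::] _ [::]).
  exact: (word_equiv_mono N1N (subxx B) (am1 _ (lett _ _ u1P) e1)).
exact: (word_equiv_mono N2N (subxx B) (am2 _ (lett _ _ u2P) e2)).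
Qed.

End Amalgams.

(** * Orbits of simple factors *)

Section Orbits.
Variables (gT : finGroupType) (p : nat).
Import GroupScope.
Local Open Scope group_scope.
Implicit Types (B G H L M N : {group gT}) (S T : {set {set gT}}).

Lemma nonabelian_simple_quasisimple M : nonabelian_simple M -> quasisimple M.
Proof.
case/andP=> simM naM; have [M1 minM] := simpleP _ simM.
have Z1 : 'Z(M) = 1.
  have [//|ZM] := minM 'Z(M)%G (center_normal M).
  by move: naM; rewrite -[X in abelian X]ZM center_abelian.
apply/andP; split; last by rewrite Z1 -(isog_simple (quotient1_isog M)).
have [M'1|-> //] := minM M^`(1)%G (der_normal 1 M).
by move: naM; rewrite abelianE (sameP commG1P eqP) -derg1 M'1 eqxx.
Qed.

Lemma nonabelian_simple_isog M N : M \isog N -> nonabelian_simple M = nonabelian_simple N.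
Proof. by move=> iso; rewrite /nonabelian_simple (isog_simple iso) (isog_abelian iso). Qed.

Lemma bigdprod_gen S N : \big[dprod/1]_(M in S) M = N -> <<cover S>> = N.
Proof. by move/bigdprodWY. Qed.

Definition stable B S := forall b X, b \in B -> X \in S -> X :^ b \in S.

Lemma stable_norm B S N : stable B S -> \big[dprod/1]_(M in S) M = N -> B \subset 'N(N).
Proof.
move=> stS /bigdprod_gen <-; apply: norms_gen; apply/subsetP => b bB.
rewrite inE; apply/subsetP => _ /imsetP[x /bigcupP[X XS xX] ->].
by apply/bigcupP; exists (X :^ b); [exact: stS | rewrite memJ_conjg].
Qed.

Lemma stable_orbit B (X : {set gT}) : stable B (X :^: B).
Proof.
move=> b _ bB /imsetP[c cB ->]; apply/imsetP; exists (c * b); first exact: groupM.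
by rewrite conjsgM.
Qed.

Lemma bigdprod_p'group S N : \big[dprod/1]_(M in S) M = N ->
  (forall X, X \in S -> p^'.-nat #|X|) -> p^'.-group N.
Proof.
move=> defN p'S; rewrite /pgroup -(bigdprod_card defN).
by elim/big_ind: _ => // m n; rewrite pnatM => -> ->.
Qed.

Lemma bigdprod_split S (T : {set {set gT}}) N : T \subset S -> \big[dprod/1]_(M in S) M = N ->
  exists N1 N2 : {group gT}, [/\ \big[dprod/1]_(M in T) M = N1,
    \big[dprod/1]_(M in S :\: T) M = N2 & N1 \x N2 = N].
Proof.
move=> TS; rewrite (big_setID T) /= (setIidPr TS) => defN.
have [[N1 N2 d1 d2] _ _ _] := dprodP defN; exists N1, N2.
by rewrite -d1 -d2.
Qed.

(** The product over a [B]-stable set is built up orbit by orbit. *)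
Lemma amalgam_stable B S N : p.-abelem B -> logn p #|B| = 3 ->
    stable B S -> \big[dprod/1]_(M in S) M = N -> p^'.-group N ->
    (forall X, X \in S -> forall H, \big[dprod/1]_(M in X :^: B) M = H -> amalgam H B) ->
  amalgam N B.
Proof.
move=> abelB rB; have [n] := ubnP #|S|; elim: n => // n IHn in S N *.
rewrite ltnS => Sn stS defN p'N orb.
have [S0|[X XS]] := set_0Vmem S.
  have [b bB b1] : exists2 b, b \in B & b != 1.
    apply/trivgPn; apply: contra_eq_neq rB => /= ->; by rewrite cards1 logn1.
  apply: (@amalgam_fixed gT N B b); first by rewrite !inE b1.
  by rewrite -defN S0 big_set0 sub1G.
have OS : X :^: B \subset S.
  by apply/subsetP => _ /imsetP[b bB ->]; exact: stS.
have stD : stable B (S :\: X :^: B).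
  move=> b Y bB /setDP[YS YO]; rewrite inE stS // andbT.
  apply: contra YO => YO; rewrite -(conjsgK b Y).
  by apply: stable_orbit YO; rewrite groupV.
have [N1 [N2 [d1 d2 defN']]] := bigdprod_split OS defN.
have [_ NE _ _] := dprodP defN'.
have N2N : N2 \subset N by rewrite -NE mulG_subr.
apply: (amalgam_dprod defN' p'N _ _ abelB rB).
- exact: stable_norm (@stable_orbit B X) d1.
- exact: stable_norm stD d2.
- exact: orb d1.
apply: IHn d2 _ _ => //.
- apply: leq_trans Sn; apply: proper_card; rewrite properE subsetDl /=.
  apply/subsetPn; exists X => //; rewrite inE negb_and negbK.
  by apply/orP; left; apply/imsetP; exists 1; rewrite ?conjsg1 ?group1.
- exact: pgroupS N2N p'N.
by move=> Y /setDP[YS _]; exact: orb.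
Qed.

End Orbits.

(** * The rank three reduction *)

Section RankThree.
Variables (gT : finGroupType) (p : nat).
Import GroupScope.
Local Open Scope group_scope.
Implicit Types (A B G L M N : {group gT}).

Lemma nilpotent_normal_simple M (H : {group gT}) :
  nonabelian_simple M -> nilpotent H -> H <| M -> H :=: 1.
Proof.
case/andP=> /simpleP[M1 minM] naM nilH nHM; have [//|HM] := minM H nHM.
have [ZM|ZM] := minM 'Z(M)%G (center_normal M).
  by case/eqP: M1; apply/eqP; rewrite -center_nil_eq1 ?ZM // -HM.
by case/negP: naM; rewrite -[X in abelian X]ZM center_abelian.
Qed.

Lemma orbit_center M B N : nonabelian_simple M -> \big[dprod/1]_(X in M :^: B) X = N ->
  'Z(N) = 1.
Proof.
move=> simM /center_bigdprod <-; apply: big1 => _ /imsetP[b bB ->].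
have : nonabelian_simple (M :^ b)%G by rewrite -(nonabelian_simple_isog (conj_isog _ _)).
case/andP => /simpleP[_ minM] naM.
have [//|ZM] := minM 'Z(M :^ b)%G (center_normal _).
by case/negP: naM; rewrite /= -[X in abelian X]ZM center_abelian.
Qed.

(** The subgroup generated by an orbit is its own generalized Fitting subgroup in
    the extension by [B].
    - Fitting subgroup: it meets each simple factor trivially, hence commutes
      with all of them and meets [N] in the trivial center of [N].  It is
      therefore a normal [p]-subgroup, contained in the Sylow subgroup [B], and
      centralizes [N]; by faithfulness it is trivial.
    - Components: they are perfect and [N <*> B] is abelian modulo [N], so they
      lie in [N]; conversely the conjugates of [M] are components. *)
Lemma orbit_hypotheses B M N : p.-abelem B -> logn p #|B| = 3 ->
    nonabelian_simple M -> p^'.-group M -> \big[dprod/1]_(X in M :^: B) X = N ->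
    'C_B(N) = 1 ->
  aschbacher_hypotheses p 3 (N <*> B)%G B M.
Proof.
move=> abelB rB simM p'M defN faithful.
set G := (N <*> B)%G.
have nNB : B \subset 'N(N) := stable_norm (@stable_orbit _ B M) defN.
have NG : N \subset G by exact: joing_subl.
have BG : B \subset G by exact: joing_subr.
have defG : N * B = G by rewrite /G /= norm_joinEr.
have nNG : N <| G by rewrite /normal NG join_subG normG.
have pB := abelem_pgroup abelB.
have p'N : p^'.-group N.
  by apply: bigdprod_p'group defN _ => _ /imsetP[b _ ->]; rewrite cardJg.
have conjM b : nonabelian_simple (M :^ b)%G.
  by rewrite -(nonabelian_simple_isog (conj_isog _ _)).
have orbM b : b \in B -> M :^ b \in M :^: B by move=> bB; apply/imsetP; exists b.
have normMb b : b \in B -> (M :^ b)%G <| N.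
  move=> bB; have [N1 [N2 [d1 _ defN']]] : exists N1 N2 : {group gT},
     [/\ \big[dprod/1]_(X in [set M :^ b]) X = N1,
       \big[dprod/1]_(X in (M :^: B) :\: [set M :^ b]) X = N2 & N1 \x N2 = N].
    by apply: bigdprod_split defN; rewrite sub1set orbM.
  have [nN1 _] := dprod_normal2 defN'.
  by move: d1; rewrite big_set1 => d1; rewrite /= d1.
have compM b : b \in B -> component (M :^ b)%G G.
  move=> bB; rewrite /component nonabelian_simple_quasisimple // andbT.
  exact: subnormal_trans (normal_subnormal (normMb b bB)) (normal_subnormal nNG).
have F1 : 'F(G) = 1.
  have nFG : 'F(G) <| G := Fitting_normal G.
  have FN : 'F(G) :&: N = 1.
    apply/trivgP; rewrite -(orbit_center simM defN).
    change ('F(G) :&: N \subset 'C_N(N)); rewrite subsetI subsetIr /=.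
    rewrite -[X in 'C(X)](bigdprod_gen defN) cent_gen; apply/centsP => x.
    case/setIP=> xF xN y /bigcupP[X /imsetP[b bB ->{X}] yM].
    have [Mb nMb] := andP (normMb b bB).
    have FM : M :^ b :&: 'F(G) = 1.
      apply: (@nilpotent_normal_simple (M :^ b)%G (M :^ b :&: 'F(G))%G) => //.
        exact: nilpotentS (subsetIr _ _) (Fitting_nil G).
      exact: normalGI (subset_trans Mb NG) nFG.
    apply/commgP; rewrite -in_set1 -[[set 1]]FM; apply/setIP; split.
      by rewrite commgEr groupMr // memJ_norm ?groupV // (subsetP nMb).
    have nFy : y \in 'N('F(G)).
      by rewrite (subsetP (normal_norm nFG)) // (subsetP NG) // (subsetP Mb).
    by rewrite commgEl groupMl ?groupV // memJ_norm.
  have pF : p.-group 'F(G).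
    have nFN : 'F(G) \subset 'N(N) := subset_trans (Fitting_sub G) (normal_norm nNG).
    rewrite /pgroup (card_isog (quotient_isog nFN _)) 1?setIC //.
    apply: pgroupS (quotient_pgroup N pB).
    have eGN : G / N = B / N by rewrite -defG quotientMidl.
    by change ('F(G) / N \subset B / N); rewrite -eGN quotientS ?Fitting_sub.
  have FB : 'F(G) \subset B.
    apply: subset_trans (pcore_sub_Hall (coprime_complement_Sylow pB p'N defG)).
    exact: pcore_max pF nFG.
  apply/trivgP; rewrite -faithful subsetI FB /=.
  apply/commG1P/trivgP; rewrite -FN subsetI commg_subl commg_subr.
  rewrite (subset_trans NG (normal_norm nFG)).
  exact: subset_trans (Fitting_sub G) (normal_norm nNG).
have layG : layer G = N.
  apply/eqP; rewrite eqEsubset gen_subG; apply/andP; split.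
    apply/bigcupsP => H /andP[sHG /andP[/eqP H' _]].
    apply: subset_trans (_ : G^`(1) \subset N).
      by rewrite -H' dergS // subnormal_sub.
    apply: der1_min; first exact: normal_norm.
    by rewrite -defG quotientMidl quotient_abelian // (abelem_abelian abelB).
  rewrite -{1}(bigdprod_gen defN); apply: genS; apply/bigcupsP => _ /imsetP[b bB ->].
  by apply: (bigcup_sup (M :^ b)%G); exact: compM.
have defFG : generalized_Fitting G = N.
  by rewrite /generalized_Fitting F1 layG joing1G.
split=> //.
- by rewrite (card_pgroup pB) rB.
- by rewrite defFG -defG normC.
rewrite defFG; split=> //.
by have := compM 1 (group1 B); congr (component _ _); apply/val_inj; rewrite /= conjsg1.
Qed.

(** The rank 3 cases that are used have the same ambient group type, and a
    component isomorphic to [L]; both parts of the main theorem follow. *)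
Theorem rank_three_reduction (R : realType) r G A L : prime p -> 3 <= r ->
    aschbacher_hypotheses p r G A L ->
    (forall G' B M, aschbacher_hypotheses p 3 G' B M -> M \isog L ->
       Ap_simply_connected R p G') ->
  Ap_simply_connected R p G.
Proof.
move=> p_pr r3 [abelA oA AG defG [compL simL p'L defF]] rank3.
have [N defN] : exists N : {group gT}, generalized_Fitting G = N.
  by exists ('F(G) <*> layer G)%G.
rewrite {}defN in defG defF.
have p'N : p^'.-group N.
  by apply: bigdprod_p'group defF _ => _ /imsetP[b _ ->]; rewrite cardJg.
have nNA : A \subset 'N(N) := stable_norm (@stable_orbit _ A L) defF.
have pA := abelem_pgroup abelA.
have rA : 3 <= logn p #|A| by rewrite oA pfactorK.
have [B BA3] := abelem_pnElem abelA rA.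
have [BA abelB rB] := pnElemP BA3.
have [E EB2] : exists E, E \in 'E_p^2(B) by apply: abelem_pnElem => //; rewrite rB.
have EA2 := subsetP (pnElemS p 2 BA) _ EB2.
have A1 : A :!=: 1 by apply: contra_leqN rA => /eqP ->; rewrite cards1 logn1.
have B1 : B :!=: 1 by apply: contra_eqN rB => /eqP ->; rewrite cards1 logn1.
have amB : amalgam N B.
  apply: (amalgam_stable (S := L :^: A) abelB rB _ defF p'N).
    by move=> b X bB; apply: stable_orbit; exact: (subsetP BA).
  move=> X /imsetP[a aA ->{X}] H defH; set M := (L :^ a)%G.
  have isoM : M \isog L by rewrite isog_sym conj_isog.
  have p'M : p^'.-group M by rewrite /pgroup cardJg.
  have simM : nonabelian_simple M by rewrite (nonabelian_simple_isog isoM).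
  have [faith|/trivgPn[b /setIP[bB bH] b1]] := eqVneq 'C_B(H) 1; last first.
    apply: (@amalgam_fixed gT H B b); first by rewrite !inE b1.
    by rewrite sub_cent1.
  have hyp := orbit_hypotheses abelB rB simM p'M defH faith.
  have := simply_connected_edge (@Ap_down_closed gT p (H <*> B)%G) (rank3 _ _ _ hyp isoM).
  have nHB : B \subset 'N(H) := stable_norm (@stable_orbit _ B M) defH.
  apply: (edge_simply_connected_amalgam abelB B1 _ nHB).
    by apply: bigdprod_p'group defH _ => _ /imsetP[b _ ->]; rewrite cardJg.
  by rewrite /= norm_joinEr.
have amA := amalgam_mono abelA p'N nNA BA EB2 amB.
have defG' : N * A = G by rewrite -normC.
apply: (@edge_simply_connected_realization R _ (Ap_complex p G) (@Ap_down_closed _ p G)).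
apply: (amalgam_edge_simply_connected abelA A1 p'N nNA defG' _ amA) => x xN.
have [EA _ _] := pnElemP EA2.
have EE : E \in 'E_p^2(E) by move: EA2; rewrite !inE EA subxx.
have := coprime_fixed_points p'N (subset_trans EA nNA) EE.
move/subsetP/(_ x xN)/generated_word => [w wE w1]; exists w => //.
by apply: sub_all wE => y; apply: letterS.
Qed.

End RankThree.

Theorem proposition4p7 (R : realType) (p : nat) (p_prime : prime p) :
  (aschbacher_conjecture_rank R p 3 ->
   forall r : nat, (3 <= r)%N -> aschbacher_conjecture_rank R p r) /\
  (forall (sT : finGroupType) (S : {group sT}),
     nonabelian_simple S -> (p^'.-group S)%g ->
     aschbacher_conjecture_rank_for R p 3 S ->
     forall r : nat, (3 <= r)%N -> aschbacher_conjecture_rank_for R p r S).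
Proof.
split=> [conj3 r r3 gT G A L hyp|sT S _ _ conj3 r r3 gT G A L hyp isoL].
  apply: rank_three_reduction p_prime r3 hyp _ => G' B M hyp' _.
  exact: conj3 hyp'.
apply: rank_three_reduction p_prime r3 hyp _ => G' B M hyp' isoM.
exact: conj3 hyp' (isog_trans isoM isoL).
Qed.
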